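(* Let $p$ be an odd prime, $r=\frac{p+1}{2}$ and $I=\{1,\dots,p\}\setminus\{r\}$. For any integer $w>0$ and any $(p-1)$-tuple of partitions $\alpha=(\alpha^1,\dots,\alpha^{r-1},\alpha^{r+1},\dots,\alpha^p)\Vdash w$, we have $$\operatorname{Ind}_{H_w}^{G_w}(\xi^{\alpha})=\sum_{\gamma=(\gamma^1,\dots,\gamma^p)\Vdash w}k_{\alpha,\gamma}\cdot\chi^{\gamma},$$ where, for any $p$-tuple of partitions $\gamma=(\gamma^1,\dots,\gamma^p)\Vdash w$, $$k_{\alpha,\gamma}=\sum_{\beta^i\vdash|\alpha^i|-|\gamma^i|\ (i\in I)}\left(\prod_{i\in I}c^{\alpha^i}_{\beta^i,\gamma^i}\right)\cdot c^{\gamma^r}_{(\beta^i,\,i\in I)},$$ the sum running over all families $(\beta^i)_{i\in I}$ of partitions with $\beta^i\vdash|\alpha^i|-|\gamma^i|$ for all $i\in I$. In particular, $k_{\alpha,\gamma}=0$ unless $|\gamma^i|\le|\alpha^i|$ for all $i\in I$.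
   Context: All characters are complex. For a partition $\lambda$, $|\lambda|$ is its size, $\lambda\vdash n$ means $|\lambda|=n$, and $\chi_\lambda$ is the irreducible character of the symmetric group $\mathfrak{S}_n$ canonically labelled by $\lambda$. There is exactly one partition $\emptyset$ of $0$, $\mathfrak{S}_0$ is trivial, and there are no partitions of a negative integer. For a tuple $\alpha$ of partitions, $\alpha\Vdash w$ means that the sizes of its components add up to $w$. Wreath products. For a finite group $N$, $N\wr\mathfrak{S}_k=N^k\rtimes\mathfrak{S}_k$ has elements $(f;\pi)$, with $f=(f_1,\dots,f_k)\in N^k$, $\pi\in\mathfrak{S}_k$, and product $(f;\pi)(f';\pi')=(f'';\pi\pi')$ with $f''_a=f_a f'_{\pi^{-1}(a)}$. If $\pi=\pi_1\cdots\pi_{c(\pi)}$ is the disjoint cycle decomposition (fixed points included), and $\pi_\nu$ is a cycle of length $k_\nu$ containing $j_\nu$, the $\nu$-th cycle product of $(f;\pi)$ is $g_\nu(f;\pi)=f_{j_\nu}f_{\pi^{-1}(j_\nu)}\cdots f_{\pi^{-(k_\nu-1)}(j_\nu)}\in N$ (well defined up to conjugacy in $N$). For $\omega\in\operatorname{Irr}(N)$, $\widetilde{\omega^k}$ is the irreducible character of $N\wr\mathfrak{S}_k$ given by $\widetilde{\omega^k}(f;\pi)=\prod_{\nu=1}^{c(\pi)}\omega(g_\nu(f;\pi))$. Groups. $H=\mathbb{Z}_{p-1}$ is cyclic of order $p-1$, $G=\mathbb{Z}_p\rtimes\mathbb{Z}_{p-1}$, where $\mathbb{Z}_{p-1}$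 acts faithfully on $\mathbb{Z}_p$ (so it acts as the full automorphism group of $\mathbb{Z}_p$), and $H$ is viewed as the complement in $G$. For $k\ge0$, $G_k=G\wr\mathfrak{S}_k$ and $H_k=H\wr\mathfrak{S}_k\le G_k$ ($G_0,H_0$ trivial). If $k_1,k_2,\dots$ are non-negative integers adding up to $k$, $\prod_i G_{k_i}\le G_k$ and $\prod_i H_{k_i}\le H_k$ are the natural (Young-type) subgroups. Characters of $G$ and $H$. Write $\operatorname{Irr}(H)=\{\theta_i\mid i\in I\}$ with $\theta_1=1_H$ (a fixed labelling). $\operatorname{Irr}(G)=\{\psi_1,\dots,\psi_p\}$, where for $i\in I$, $\psi_i=\theta_i\circ\varpi$ with $\varpi\colon G\to H$ the canonical surjection with kernel $\mathbb{Z}_p$, and $\psi_r$ is the unique irreducible character of $G$ of degree $p-1$. Characters of $G_w$ and $H_w$. For $\lambda\vdash k$, define $\varphi_\lambda$ on $G_k$ and $\zeta_\lambda$ on $H_k$ by $\varphi_\lambda(f;\pi)=\chi_\lambda(\pi)$ and $\zeta_\lambda(f;\pi)=\chi_\lambda(\pi)$. For $\gamma=(\gamma^1,\dots,\gamma^p)\Vdash w$, $$\chi^\gamma=\operatorname{Ind}_{\prod_{i=1}^pG_{|\gamma^i|}}^{G_w}\Big(\prod_{i=1}^p\widetilde{\psi_i^{|\gamma^i|}}\otimes\varphi_{\gamma^i}\Big)\in\operatorname{Irr}(G_w),$$ and for $\alpha=(\alpha^i)_{i\in I}\Vdash w$, $$\xi^\alpha=\operatorname{Ind}_{\prod_{i\in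 I}H_{|\alpha^i|}}^{H_w}\Big(\prod_{i\in I}\widetilde{\theta_i^{|\alpha^i|}}\otimes\zeta_{\alpha^i}\Big)\in\operatorname{Irr}(H_w).$$ Here $\otimes$ is the pointwise product of characters of one group, and $\prod$ is the outer tensor product over the direct factors. Every irreducible character of $G_w$ (resp. $H_w$) is $\chi^\gamma$ (resp. $\xi^\alpha$) for exactly one $\gamma$ (resp. $\alpha$). Littlewood-Richardson coefficients. For $\alpha\vdash k$, $\beta\vdash j$, $\gamma\vdash k-j$ ($0\le j\le k$), $c^\alpha_{\beta,\gamma}$ is the multiplicity of the outer tensor product $\chi_\beta\boxtimes\chi_\gamma$ in $\operatorname{Res}^{\mathfrak{S}_k}_{\mathfrak{S}_j\times\mathfrak{S}_{k-j}}(\chi_\alpha)$; in particular $c^\alpha_{\emptyset,\gamma}=\delta_{\alpha,\gamma}$ and $c^\alpha_{\beta,\emptyset}=\delta_{\alpha,\beta}$. For partitions $\beta^i\vdash j_i$ ($i\in I$) and $\gamma^r\vdash\sum_{i\in I}j_i=:m$, $c^{\gamma^r}_{(\beta^i,\,i\in I)}=\big\langle\chi_{\gamma^r},\operatorname{Ind}_{\prod_{i\in I}\mathfrak{S}_{j_i}}^{\mathfrak{S}_m}\big(\prod_{i\in I}\chi_{\beta^i}\big)\big\rangle_{\mathfrak{S}_m}$. (When $|\gamma^i|\le|\alpha^i|$ for all $i\in I$, one has $\sum_{i\in I}(|\alpha^i|-|\gamma^i|)=|\gamma^r|$.) *)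

(* Defs.v *)
From HB Require Import structures.
From mathcomp Require Import all_boot all_order all_algebra all_fingroup.
From mathcomp Require Import all_solvable all_field all_character.

Set Implicit Arguments.
Unset Strict Implicit.
Unset Printing Implicit Defensive.

Import Order.TTheory GRing.Theory Num.Theory GroupScope.
Local Open Scope ring_scope.

(* Partitions of size at most w: weakly decreasing sequences of natural       *)
(* numbers, padded with zeros to length w. Every partition of size at most w  *)
(* has exactly one such representation.                                       *)
Definition part (w : nat) : finType :=
  {t : w.-tuple 'I_w.+1 | sorted geq (map val t) && (sumn (map val t) <= w)%N}.

Definition pseq w (la : part w) : seq nat := map val (val la).
Definition psize w (la : part w) : nat := sumn (pseq la).

Definition msize w (J : finType) (al : {ffun J -> part w}) : nat :=
  (\sum_j psize (al j))%N.

(* Blocks and Young subgroups. A function b : T -> nat cuts T into blocks.    *)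

Definition blk (T : finType) (b : T -> nat) (k : nat) : finType :=
  {x : T | b x == k}.

Section Young.
Variables (T : finType) (b : T -> nat).

Definition young_set : {set {perm T}} :=
  [set s : {perm T} | [forall x, b (s x) == b x]].

Fact young_group_set : group_set young_set.
Proof.
apply/group_setP; split=> [|s t]; rewrite !inE.
  by apply/forallP=> x; rewrite perm1.
move=> /forallP Ys /forallP Yt; apply/forallP=> x.
by rewrite permM (eqP (Yt _)) Ys.
Qed.
Definition young : {group {perm T}} := group young_group_set.

(* The morphism restricting a permutation that stabilises block k. *)
Definition perm_blk (k : nat) := actperm_morphism ('P^? : action _ (blk b k)).

Fact sgn_subproof :
  is_class_fun <<young>> [ffun s : {perm T} => (-1) ^+ s *+ (s \in young)].
Proof.
rewrite genGid; apply: intro_class_fun => [s t Ys Yt | s /negPf-> //].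
by rewrite odd_permJ groupJ ?Ys.
Qed.
Definition sgn_young : 'CF(young) := Cfun 0 sgn_subproof.

End Young.

(* The irreducible character of {perm T} labelled by the partition la of #|T|.*)
(* T is laid out row by row in the diagram of la; then chi_la is the unique   *)
(* common irreducible constituent of the permutation character on the cosets  *)
(* of the row stabiliser (a Young subgroup of type la) and of the character   *)
(* induced from the sign of the column stabiliser (of type the conjugate of   *)
(* la), as in James-Kerber, The Representation Theory of the Symmetric Group. *)
(* So chi_(n) = 1 and chi_(1^n) is the sign character.                        *)
(* T is an arbitrary finite type, so that blocks of 'I_n may be used.         *)
Section SymChar.
Variables (T : finType) (la : seq nat).

Definition row_of (x : T) : nat := reshape_index la (enum_rank x).
Definition col_of (x : T) : nat := reshape_offset la (enum_rank x).

Definition chi_idx : Iirr [set: {perm T}] :=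
  odflt 0 [pick i | (i \in irr_constt ('Ind (1 : 'CF(young row_of))))
                    && (i \in irr_constt ('Ind (sgn_young col_of)))].

Definition chi : 'CF([set: {perm T}]) := 'chi_chi_idx.

End SymChar.

(* The natural (consecutive) cutting of 'I_n into blocks of sizes s j, j : J, *)
(* in the order of enum J; block j carries the number enum_rank j.            *)
Definition nat_blocks (J : finType) (s : J -> nat) n (x : 'I_n) : nat :=
  reshape_index [seq s j | j <- enum J] x.

Section LittlewoodRichardson.
Variables (J : finType) (mu : J -> seq nat) (n : nat).

Definition young_type : {group 'S_n} := young (@nat_blocks J (sumn \o mu) n).

(* The outer tensor product of the chi_(mu j). *)
Definition chi_outer : 'CF(young_type) :=
  \prod_j cfMorph
    ('Res[perm_blk _ (enum_rank j) @* young_type]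
       (chi (blk (@nat_blocks J (sumn \o mu) n) (enum_rank j)) (mu j))).

End LittlewoodRichardson.

(* c^al_{be, ga}; be comes first since enum bool = [:: true; false]. *)
Definition LR2 w (al be ga : part w) : algC :=
  let mu (j : bool) := if j then pseq be else pseq ga in
  '['Res[young_type mu (psize al)] (chi 'I_(psize al) (pseq al)),
    chi_outer mu (psize al)].

(* c^ga_{(be j, j : J)} *)
Definition LRfam w (J : finType) (ga : part w) (be : J -> part w) : algC :=
  '[chi 'I_(psize ga) (pseq ga),
    'Ind[[set: 'S_(psize ga)]] (chi_outer (fun j => pseq (be j)) (psize ga))].

(* Wreath products. *)
Record wreath (gT : finGroupType) (T : finType) : predArgType :=
  Wreath { wbase : {ffun T -> gT}; wperm : {perm T} }.

Section WreathGroup.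
Variables (gT : finGroupType) (T : finType).
Local Notation wT := (wreath gT T).

Definition wpair (x : wT) := (wbase x, wperm x).
Definition unwpair (u : {ffun T -> gT} * {perm T}) : wT := Wreath u.1 u.2.
Fact wpairK : cancel wpair unwpair. Proof. by case. Qed.
HB.instance Definition _ := Finite.copy wT (can_type wpairK).

(* The product pi pi' is the composition "pi' first, then pi", which MathComp *)
(* writes pi' * pi since (s * t) x = t (s x).                                 *)
Definition wr_mul (x y : wT) : wT :=
  Wreath [ffun a => (wbase x a * wbase y ((wperm x)^-1 a))%g]
         (wperm y * wperm x)%g.
Definition wr_one : wT := Wreath [ffun=> 1%g] 1%g.
Definition wr_inv (x : wT) : wT :=
  Wreath [ffun a => ((wbase x (wperm x a))^-1)%g] (wperm x)^-1%g.

Fact wr_mulA : associative wr_mul.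
Proof.
move=> x y z; congr Wreath; last by rewrite /= mulgA.
by apply/ffunP=> a; rewrite !ffunE /= invMg permM mulgA.
Qed.
Fact wr_mul1 : left_id wr_one wr_mul.
Proof.
case=> f s; congr Wreath; last by rewrite /= mulg1.
by apply/ffunP=> a; rewrite !ffunE /= invg1 perm1 mul1g.
Qed.
Fact wr_mulV : left_inverse wr_one wr_inv wr_mul.
Proof.
move=> x; congr Wreath; last by rewrite /= mulgV.
by apply/ffunP=> a; rewrite !ffunE /= invgK mulVg.
Qed.
HB.instance Definition _ := Finite_isGroup.Build wT wr_mulA wr_mul1 wr_mulV.

Lemma wbaseM (x y : wT) a :
  wbase (x * y)%g a = (wbase x a * wbase y ((wperm x)^-1 a))%g.
Proof. by rewrite [LHS]ffunE. Qed.
Lemma wpermM (x y : wT) : wperm (x * y)%g = (wperm y * wperm x)%g.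
Proof. by []. Qed.
Lemma wbaseV (x : wT) a : wbase (x^-1)%g a = ((wbase x (wperm x a))^-1)%g.
Proof. by rewrite [LHS]ffunE. Qed.
Lemma wpermV (x : wT) : wperm (x^-1)%g = ((wperm x)^-1)%g.
Proof. by []. Qed.
Lemma wbase1 a : wbase (1%g : wT) a = 1%g.
Proof. by rewrite [LHS]ffunE. Qed.

Lemma wbaseJ (x y : wT) a (b := wperm y a) :
  wbase (x ^ y)%g a =
    ((wbase y b)^-1 * wbase x b * wbase y ((wperm x)^-1 b))%g.
Proof. by rewrite /conjg !wbaseM !wbaseV !wpermV !invgK !mulgA. Qed.
Lemma wpermJ (x y : wT) :
  wperm (x ^ y)%g = (wperm x ^ (wperm y)^-1)%g.
Proof. by rewrite /conjg !wpermM wpermV invgK !mulgA. Qed.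

Section Subgroups.
Variable N : {group gT}.

Definition wr_set : {set wT} := [set x | [forall a, wbase x a \in N]].

Fact wr_group_set : group_set wr_set.
Proof.
apply/group_setP; split=> [|x y]; rewrite !inE.
  by apply/forallP=> a; rewrite wbase1 group1.
move=> /forallP Nx /forallP Ny; apply/forallP=> a.
by rewrite wbaseM groupM.
Qed.
Definition wr : {group wT} := group wr_group_set.

Variable b : T -> nat.

Definition wr_young_set : {set wT} :=
  [set x | (x \in wr) && (wperm x \in young b)].

Fact wr_young_group_set : group_set wr_young_set.
Proof.
apply/group_setP; split=> [|x y]; first by rewrite in_set !group1.
rewrite in_set => /andP[Nx Yx]; rewrite in_set => /andP[Ny Yy].
by rewrite in_set groupM //=; exact: groupM Yy Yx.
Qed.
Definition wr_young : {group wT} := group wr_young_group_set.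

End Subgroups.

End WreathGroup.

(* The projection of a Young-type subgroup of a wreath product on its factor  *)
(* attached to block k.                                                       *)
Section WreathBlock.
Variables (gT : finGroupType) (T : finType) (b : T -> nat) (k : nat).

Definition wr_blk_fun (x : wreath gT T) : wreath gT (blk b k) :=
  Wreath [ffun a : blk b k => wbase x (val a)] (perm_blk b k (wperm x)).

Lemma young_sub_dom : young b \subset subact_dom (fun x => b x == k) 'P.
Proof.
apply/subsetP=> s; rewrite inE => /forallP Ys.
rewrite !inE /=; apply/subsetP=> x; rewrite !inE /= => bx.
by rewrite apermE (eqP (Ys x)).
Qed.

Lemma perm_blkE s (a : blk b k) : s \in young b ->
  val (perm_blk b k s a) = s (val a).
Proof.
by move=> /(subsetP young_sub_dom) Ds; rewrite /= actpermE val_subact Ds.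
Qed.

Fact wr_blk_morphM :
  {in wr_young [set: gT] b &, {morph wr_blk_fun : x y / (x * y)%g}}.
Proof.
move=> x y; rewrite in_set => /andP[_ Yx]; rewrite in_set => /andP[_ Yy].
congr Wreath; last first.
  by rewrite wpermM morphM ?(subsetP young_sub_dom).
apply/ffunP=> a; rewrite [LHS]ffunE [RHS]ffunE wbaseM /= !ffunE.
congr (_ * wbase y _)%g.
have YVx : (wperm x)^-1%g \in young b by rewrite groupV.
by rewrite -[RHS]/(val ((perm_blk b k (wperm x))^-1%g a)) -morphV ?perm_blkE
           ?(subsetP young_sub_dom).
Qed.
Definition wr_blk := Morphism wr_blk_morphM.

End WreathBlock.

Section WreathChars.
Variables (gT : finGroupType) (T : finType) (N : {group gT}).
Implicit Types (x y : wreath gT T) (om : 'CF(N)).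

(* The product of the cycle containing j, starting at j. *)
Definition cycprod x (j : T) : gT :=
  (\prod_(m < #|porbit (wperm x) j|) wbase x ((wperm x ^- m) j))%g.

Lemma cycprod_in x j : x \in wr T N -> cycprod x j \in N.
Proof. by rewrite inE => /forallP Nx; apply: group_prod. Qed.

Lemma porbit_expV (s : {perm T}) j : (s ^- #|porbit s j|)%g j = j.
Proof.
by apply: (@perm_inj _ (s ^+ #|porbit s j|)%g); rewrite permKV permX
   iter_porbit.
Qed.

Lemma telescope_conj (h g : nat -> gT) n :
  (\prod_(m < n) ((h m)^-1 * g m * h m.+1))%g =
  ((h 0)^-1 * (\prod_(m < n) g m) * h n)%g.
Proof.
elim: n => [|n IHn]; first by rewrite !big_ord0 mulg1 mulVg.
by rewrite !big_ord_recr /= IHn !mulgA mulgK.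
Qed.

Lemma porbitJ (s t : {perm T}) j :
  porbit s (t j) = [set t i | i in porbit (s ^ t^-1)%g j].
Proof.
have XE i : (((s ^ t^-1) ^+ i)%g j) = (t^-1)%g ((s ^+ i)%g (t j)).
  by rewrite -conjXg /conjg invgK !permM.
apply/setP=> a; apply/porbitP/imsetP=> [[i ->]|[c /porbitP[i ->] ->]].
  by exists ((t^-1)%g ((s ^+ i)%g (t j))); rewrite ?permKV // -XE mem_porbit.
by exists i; rewrite XE permKV.
Qed.

Lemma cycprodJ x y j (b := wperm y j) :
  cycprod (x ^ y)%g j = (cycprod x b ^ wbase y b)%g.
Proof.
rewrite /cycprod wpermJ porbitJ card_imset; last exact: perm_inj.
set n := #|_|; pose h m := wbase y ((wperm x ^- m) b)%g.
pose g m := wbase x ((wperm x ^- m) b)%g.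
rewrite (eq_bigr (fun m : 'I_n => (h m)^-1 * g m * h m.+1)%g); last first.
  move=> m _; rewrite wbaseJ.
  have -> : wperm y (((wperm x ^ (wperm y)^-1) ^- m)%g j) =
            ((wperm x ^- m) b)%g.
    by rewrite -conjXg -conjVg conjgE invgK !permM permKV.
  by rewrite /h expgS invMg permM.
rewrite telescope_conj /h expg0 invg1 perm1 conjgE -!mulgA; congr (_ * (_ * wbase y _))%g.
have -> : n = #|porbit (wperm x) b|.
  by rewrite /b porbitJ card_imset //; exact: perm_inj.
by rewrite porbit_expV.
Qed.

Lemma cycprod_step x j : let i := ((wperm x)^-1)%g j in
  cycprod x i = (cycprod x j ^ wbase x j)%g.
Proof.
set s := wperm x => /=; rewrite /cycprod -/s.
have -> : porbit s (s^-1%g j) = porbit s j.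
  by rewrite -!(porbitV s) -[s^-1%g in LHS]expg1 porbit_perm.
set n := #|_|; pose g m := wbase x ((s ^- m) j)%g.
have E : (g 0 * \prod_(m < n) g m.+1 = (\prod_(m < n) g m) * g n)%g.
  by rewrite -[LHS](big_ord_recl n (fun i : 'I_n.+1 => g i)) big_ord_recr.
have g0 : g 0 = wbase x j by rewrite /g expg0 invg1 perm1.
have gn : g n = g 0 by rewrite /g porbit_expV expg0 invg1 perm1.
rewrite conjgE -g0.
transitivity ((g 0)^-1 * ((\prod_(m < n) g m) * g n))%g; last by rewrite gn.
rewrite -E mulKg.
by apply: eq_bigr => m _; rewrite /g expgSr invMg permM.
Qed.

Lemma cycprod_porbit om x i j : x \in wr T N -> i \in porbit (wperm x) j ->
  om (cycprod x i) = om (cycprod x j).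
Proof.
move=> Nx; rewrite -porbitV => /porbitP[n ->].
elim: n => [|n IHn]; first by rewrite expg0 perm1.
rewrite expgSr permM cycprod_step cfunJ //.
by move: Nx; rewrite inE => /forallP.
Qed.

(* The product over the cycles c of wperm x of om evaluated at the cycle      *)
(* product of c; the choice of the starting point j in c is irrelevant by     *)
(* cycprod_porbit.                                                            *)
Definition tilde_fun (om : 'CF(N)) x : algC :=
  \prod_(c in porbits (wperm x))
    (if [pick j in c] is Some j then om (cycprod x j) else 1).

Lemma tilde_funJ om : {in wr T N &, forall x y,
  tilde_fun om (x ^ y)%g = tilde_fun om x}.
Proof.
move=> x y Nx Ny; rewrite /tilde_fun wpermJ.
set s := wperm x; set t := wperm y.
have -> : porbits s = [set t @: (c : {set T}) | c in porbits (s ^ t^-1)%g].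
  apply/setP=> c; apply/imsetP/imsetP=> [[j _ ->]|[d /imsetP[j _ ->] ->]].
    exists (porbit (s ^ t^-1)%g (t^-1%g j)); first exact: imset_f.
    by rewrite -porbitJ permKV.
  by exists (t j); rewrite ?porbitJ.
rewrite [RHS]big_imset; last first.
  by move=> c d _ _ /=; exact: (imset_inj (@perm_inj _ t)).
apply: eq_bigr => c /imsetP[j _ ->]; rewrite -porbitJ.
case: pickP => [i ji | /(_ j)]; last by rewrite porbit_id.
case: pickP => [k jk | /(_ (t j))]; last by rewrite porbit_id.
rewrite cycprodJ cfunJ; last by move: Ny; rewrite inE => /forallP.
rewrite -/t (cycprod_porbit om Nx jk); apply: cycprod_porbit => //.
by rewrite -/s porbitJ imset_f.
Qed.

Fact tilde_subproof om : is_class_fun <<wr T N>>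
  [ffun x => tilde_fun om x *+ (x \in wr T N)].
Proof.
rewrite genGid; apply: intro_class_fun => [x y Nx Ny | x /negPf-> //].
by rewrite Nx groupJ // tilde_funJ.
Qed.
Definition tilde om : 'CF(wr T N) := Cfun 0 (tilde_subproof om).

(* The character (f; pi) |-> chi_la(pi). *)
Fact infl_subproof (la : seq nat) : is_class_fun <<wr T N>>
  [ffun x => chi T la (wperm x) *+ (x \in wr T N)].
Proof.
rewrite genGid; apply: intro_class_fun => [x y Nx Ny | x /negPf-> //].
by rewrite Nx groupJ // wpermJ cfunJ ?in_setT.
Qed.
Definition infl (la : seq nat) : 'CF(wr T N) := Cfun 0 (infl_subproof la).

End WreathChars.

(* The character of N wr S_w attached to a family om of characters of N and a *)
(* family la of partitions of total size w: xi^al when om = theta, N = H, and *)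
(* chi^ga when om = psi, N = G.                                               *)
Section WreathIrr.
Variables (gT : finGroupType) (N : {group gT}) (w : nat) (J : finType).
Variables (om : J -> 'CF(N)) (la : J -> part w).

Local Notation b := (@nat_blocks J (fun j => psize (la j)) w).

Definition wr_char : 'CF(wr 'I_w N) :=
  'Ind[wr 'I_w N, wr_young N b]
    (\prod_j cfMorph
       ('Res[wr_blk gT b (enum_rank j) @* wr_young N b]
          (tilde (blk b (enum_rank j)) (om j)
           * infl (blk b (enum_rank j)) N (pseq (la j))))).

End WreathIrr.

(* With labels 1, ..., p encoded as 0, ..., p - 1 in 'I_p, the set I. *)
Definition Iset p (r : 'I_p) : finType := {i : 'I_p | i != r}.

(* The condition on be is be^i |- |al^i| - |ga^i|; no be satisfies it when    *)
(* |ga^i| > |al^i| for some i.                                                *)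
Definition kcoef p (r : 'I_p) w
    (al : {ffun Iset r -> part w}) (ga : {ffun 'I_p -> part w}) : algC :=
  \sum_(be : {ffun Iset r -> part w} |
         [forall i, psize (be i) + psize (ga (val i)) == psize (al i)]%N)
     (\prod_i LR2 (al i) (be i) (ga (val i))) * LRfam (ga r) be.

(* Main.v *)
Require Import Defs.
From mathcomp Require Import all_boot all_order all_algebra all_fingroup.
From mathcomp Require Import all_solvable all_field all_character.
From mathcomp Require Import ring.
Import Order.TTheory GRing.Theory Num.Theory GroupScope.
Local Open Scope ring_scope.

Set Implicit Arguments.
Unset Strict Implicit.
Unset Printing Implicit Defensive.

(* Fix x in G wr S_w with underlying permutation s. Inducing from a           *)
(* Young-type subgroup turns chi^gamma(x) into a sum over the s-invariant     *)
(* colourings f of the points by the labels 1, ..., p, of the product of      *)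
(* psi_(f(z)) evaluated at the cycle products of the cycles z, times the      *)
(* product of the values chi_(gamma^i)(s restricted to colour i).             *)
(* Inducing tilde(theta^k) from H wr S_k to G wr S_k gives                    *)
(* tilde((Ind theta)^k), and Ind theta_i = psi_i + psi_r. Expanding the       *)
(* product of the psi_i + psi_r over the cycles chooses an s-stable set B,    *)
(* which becomes colour r. Restricting chi_(alpha^i) to the parts of colour i *)
(* inside and outside B produces the coefficients c^(alpha^i)_(beta^i,        *)
(* gamma^i), and summing over the colourings of B by I reassembles the        *)
(* chi_(beta^i) into Ind(prod_i chi_(beta^i)) = sum c^(gamma^r)_beta          *)
(* chi_(gamma^r).                                                             *)
(* The last two steps need the chi_lambda to be all the irreducible           *)
(* characters of the symmetric group, without repetition. Mackey's formula    *)
(* and the dominance order show that a common constituent of Ind 1 and        *)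
(* Ind sgn exists for every lambda and determines lambda; since there are at  *)
(* least as many partitions as conjugacy classes, it is unique and every      *)
(* irreducible character is obtained.                                         *)

(** * Conjugacy classes of symmetric groups *)

(** Both sides are compared value by value, as sums over colourings of the points. [cfInd_wr_char]
    moves the induction from [H] to [G] inside the wreath construction, and [affine_Ind_irr]
    evaluates it on each [theta i] by Frobenius reciprocity and a degree count. [wr_char_colourings]
    then writes the resulting character, as well as each [wr_char psi ga], as a sum over colourings
    weighted by the values [chiX].

    On the left, [prod_rep_add] introduces the stable set [B], [chiX_LR2] splits each colour class
    along [B], and [sum_LRfam] reassembles the pieces inside [B]. In [wr_char_addr] a colouring by
    [I] outside [B], with [r] on [B], is the same as a colouring by ['I_p]. The two
    Littlewood-Richardson steps rest on [chi_idx_onto]: the labelling is injective by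
    [common_constt_inj], and [card_classes_perm] bounds the number of classes by the number of
    labels. *)

Section CycleType.
Variable T : finType.
Implicit Types s t : {perm T}.

Lemma expg_mod_porbit s r k : (s ^+ (k %% #|porbit s r|))%g r = (s ^+ k)%g r.
Proof.
set n := #|_|.
rewrite [in RHS](divn_eq k n) expgD permM; congr (_ _).
rewrite mulnC expgM permX; elim: (_ %/ _)%N => //= q <-.
by rewrite permX iter_porbit.
Qed.

Lemma porbit_expg_eq s r m i :
  ((s ^+ m)%g r == (s ^+ i)%g r) = (m == i %[mod #|porbit s r|]).
Proof.
have n_gt0 : (0 < #|porbit s r|)%N by rewrite lt0n card_porbit_neq0.
rewrite -(expg_mod_porbit s r m) -(expg_mod_porbit s r i) !permX.
rewrite -!(nth_traject _ (ltn_pmod _ n_gt0)).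
by rewrite nth_uniq ?size_traject ?ltn_mod ?uniq_traject_porbit.
Qed.

Definition cycle_enum s := sort (relpre (fun c : {set T} => #|c|) geq) (enum (porbits s)).

Definition cycle_type s := map (fun c : {set T} => #|c|) (cycle_enum s).

Lemma mem_cycle_enum s c : (c \in cycle_enum s) = (c \in porbits s).
Proof. by rewrite mem_sort mem_enum. Qed.

Lemma cycle_enum_uniq s : uniq (cycle_enum s).
Proof. by rewrite sort_uniq enum_uniq. Qed.

Lemma cycle_type_sorted s : sorted geq (cycle_type s).
Proof.
rewrite /cycle_type /cycle_enum -sort_map; apply: sort_sorted => m n.
exact: leq_total.
Qed.

Lemma sumn_cycle_type s : sumn (cycle_type s) = #|T|.
Proof.
rewrite sumnE big_map (perm_big (enum (porbits s))); last by rewrite perm_sort.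
rewrite big_enum /= -(cardsT T); apply/esym/card_partition.
apply/and3P; split.
- rewrite eqEsubset subsetT; apply/subsetP=> a _; apply/bigcupP.
  by exists (porbit s a); rewrite ?porbit_id // imset_f.
- apply/trivIsetP=> _ _ /imsetP[a _ ->] /imsetP[b _ ->] neq.
  rewrite -setI_eq0; apply: contraNT neq => /set0Pn[d /setIP[da db]].
  by move: da db; rewrite -!eq_porbit_mem => /eqP <- /eqP->.
- apply/imsetP=> -[a _ a0]; have := porbit_id s a.
  by rewrite -a0 inE.
Qed.

Lemma cycle_type_gt0 s k : k \in cycle_type s -> (0 < k)%N.
Proof.
case/mapP=> c; rewrite mem_cycle_enum => /imsetP[a _ ->] ->.
by rewrite lt0n card_porbit_neq0.
Qed.

(** Cycles of [s] and [t] at the same position of the sorted lists have the same length. With a base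
    point in each cycle, sending the [m]-th iterate of one base point to the [m]-th iterate of the
    other gives the conjugating permutation. *)
Lemma cycle_type_conj s t :
  cycle_type s = cycle_type t -> exists y : {perm T}, forall a, y (s a) = t (y a).
Proof.
move=> eq_st; have eq_sz : size (cycle_enum s) = size (cycle_enum t).
  by have := congr1 size eq_st; rewrite !size_map.
pose phi c := nth set0 (cycle_enum t) (index c (cycle_enum s)).
have phi_lt c : c \in porbits s -> (index c (cycle_enum s) < size (cycle_enum t))%N.
  by rewrite -eq_sz index_mem mem_cycle_enum.
have phiP c : c \in porbits s -> phi c \in porbits t.
  by move=> sc; rewrite -mem_cycle_enum mem_nth ?phi_lt.
have phi_card c : c \in porbits s -> #|phi c| = #|c|.
  move=> sc; rewrite -(nth_map set0 0%N (fun c : {set T} => #|c|)) ?phi_lt //.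
  have -> : map (fun c : {set T} => #|c|) (cycle_enum t) = cycle_type t by [].
  rewrite -eq_st (nth_map set0) ?eq_sz ?phi_lt //.
  by rewrite nth_index // mem_cycle_enum.
have phi_inj c d : c \in porbits s -> d \in porbits s -> phi c = phi d -> c = d.
  move=> sc sd /eqP; rewrite nth_uniq ?phi_lt ?cycle_enum_uniq // => /eqP.
  by move/index_inj; apply; rewrite ?mem_cycle_enum.
pose rs a := odflt a [pick j in porbit s a].
pose rt a := odflt a [pick j in phi (porbit s a)].
have rsP a : rs a \in porbit s a.
  by rewrite /rs; case: pickP => //= _; rewrite porbit_id.
have rtP a : rt a \in phi (porbit s a).
  rewrite /rt; case: pickP => //= phi0.
  have /eqP : #|phi (porbit s a)| != 0%N.
    by rewrite phi_card ?imset_f // card_porbit_neq0.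
  by case; apply: eq_card0.
have rtE a : phi (porbit s a) = porbit t (rt a).
  have /phiP/imsetP[b _ e] : porbit s a \in porbits s by apply: imset_f.
  by rewrite e; apply/eqP; rewrite eq_sym eq_porbit_mem -e rtP.
have rsE a b : b \in porbit s a -> rs b = rs a.
  rewrite -eq_porbit_mem => /eqP ba; rewrite /rs ba.
  by case: pickP => // /(_ a); rewrite porbit_id.
have rt_congr a b : b \in porbit s a -> rt b = rt a.
  rewrite -eq_porbit_mem => /eqP ba; rewrite /rt ba.
  by case: pickP => // /(_ (rt a)); rewrite rtP.
have has_idx a : exists m, (s ^+ m)%g (rs a) == a.
  by have := rsP a; rewrite porbit_sym => /porbitP[m am]; exists m; rewrite -am.
pose idx a := ex_minn (has_idx a).
have idxE a : (s ^+ idx a)%g (rs a) = a.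
  by rewrite /idx; case: ex_minnP => m /eqP.
have eq_card a : #|porbit t (rt a)| = #|porbit s (rs a)|.
  have /eqP-> : porbit s (rs a) == porbit s a by rewrite eq_porbit_mem rsP.
  by rewrite -rtE phi_card // imset_f.
pose f a := (t ^+ idx a)%g (rt a).
(* Equal cycle lengths make the image independent of the exponent chosen to reach [a]. *)
have fE a m : (s ^+ m)%g (rs a) = a -> f a = (t ^+ m)%g (rt a).
  move=> am; apply/eqP; rewrite porbit_expg_eq eq_card -porbit_expg_eq.
  by rewrite idxE am.
have f_inj : injective f.
  move=> a b eq_ab; have fphi d : f d \in phi (porbit s d).
    by rewrite rtE mem_porbit.
  have ab : porbit s a = porbit s b.
    apply: phi_inj; rewrite ?imset_f //.
    have := fphi b; have := fphi a; rewrite eq_ab !rtE -!eq_porbit_mem.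
    by move=> /eqP-> /eqP.
  have ba : b \in porbit s a by rewrite -eq_porbit_mem ab.
  move/eqP: eq_ab; rewrite {2}/f (rt_congr _ _ ba) porbit_expg_eq eq_card.
  rewrite -porbit_expg_eq => /eqP; rewrite idxE => ->.
  by rewrite -(rsE _ _ ba) idxE.
exists (perm f_inj) => a; rewrite !permE.
have sa : s a \in porbit s a by have := mem_porbit s 1 a; rewrite expg1.
rewrite (@fE _ (idx a).+1); last by rewrite (rsE _ _ sa) expgSr permM idxE.
by rewrite (rt_congr _ _ sa) expgSr permM.
Qed.

End CycleType.

Lemma pseq_surj w (l : seq nat) :
    sorted geq l -> (sumn l <= w)%N -> (size l <= w)%N ->
  exists la : part w, pseq la = l ++ nseq (w - size l) 0%N.
Proof.
move=> l_sorted l_sum l_size; set v := _ ++ _.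
have sz_v : size v == w by rewrite size_cat size_nseq subnKC.
have sum_v : sumn v = sumn l by rewrite sumn_cat sumn_nseq mul0n addn0.
have le_v m : m \in v -> (m < w.+1)%N.
  move=> vm; rewrite ltnS (leq_trans _ l_sum) // -sum_v.
  by rewrite sumnE (big_rem m) //= leq_addr.
have geq_trans : transitive geq by move=> b a c ab /leq_trans; apply.
have v_sorted : sorted geq v.
  rewrite (sorted_pairwise geq_trans) pairwise_cat -(sorted_pairwise geq_trans).
  rewrite l_sorted /=; apply/andP; split.
    by apply/allrelP=> a b _; rewrite mem_nseq => /andP[_ /eqP->].
  by elim: (w - _)%N => //= k ->; rewrite andbT all_nseq orbT.
pose t : w.-tuple 'I_w.+1 := map_tuple inord (Tuple sz_v).
have tE : map val t = v.
  rewrite -map_comp -[RHS]map_id; apply/eq_in_map => m vm /=.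
  by rewrite inordK ?le_v.
have tP : sorted geq (map val t) && (sumn (map val t) <= w)%N.
  by rewrite tE v_sorted sum_v.
by exists (exist _ t tP).
Qed.

(** The cycle type of a representative, padded with zeros, is a partition of [#|T|], and by
    [cycle_type_conj] it separates the classes. Only this inequality is required; equality follows
    once the labelling of characters is known to be injective. *)
Lemma card_classes_perm (T : finType) w : (#|T| <= w)%N ->
  (#|classes [set: {perm T}]| <= #|[set la : part w | psize la == #|T|]|)%N.
Proof.
move=> leTw; pose S := [set: {perm T}].
have sz (s : {perm T}) : (size (cycle_type s) <= #|T|)%N.
  rewrite -(sumn_cycle_type s).
  elim: (cycle_type s) (@cycle_type_gt0 _ s) => //= m l IHl l_gt0.
  rewrite -add1n leq_add //; first by rewrite l_gt0 ?mem_head.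
  by apply: IHl => k lk; rewrite l_gt0 // inE lk orbT.
have ex (s : {perm T}) : exists la : part w,
    pseq la == cycle_type s ++ nseq (w - size (cycle_type s)) 0%N.
  have [||la laE] := pseq_surj (w := w) (cycle_type_sorted s).
  - by rewrite sumn_cycle_type.
  - exact: leq_trans (sz s) leTw.
  - by exists la; rewrite laE.
pose f (c : {set {perm T}}) := xchoose (ex (repr c)).
have fE c : filter (leq 1) (pseq (f c)) = cycle_type (repr c).
  rewrite (eqP (xchooseP (ex (repr c)))) filter_cat.
  rewrite (all_filterP _); last by apply/allP=> k /cycle_type_gt0.
  have -> : filter (leq 1) (nseq (w - size (cycle_type (repr c))) 0%N) = [::].
    by elim: (w - _)%N.
  by rewrite cats0.
rewrite -(@card_in_imset _ _ f); last first.
  move=> c d /repr_classesP[_ cE] /repr_classesP[_ dE].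
  move=> /(congr1 (fun la => filter (leq 1) (pseq la))).
  rewrite !fE => /cycle_type_conj[z zE]; rewrite cE dE.
  rewrite -(@classGidl _ [set: {perm T}]%G (repr c) z) ?inE //.
  congr (_ ^: _); apply/permP=> a; rewrite -[a](permKV z) permJ.
  by rewrite zE permKV.
apply/subset_leq_card/subsetP=> _ /imsetP[c _ ->]; rewrite inE /psize.
rewrite (eqP (xchooseP (ex (repr c)))) sumn_cat sumn_nseq mul0n addn0.
by rewrite sumn_cycle_type.
Qed.

(** * The irreducible characters of symmetric groups *)

(** Mackey's formula, obtained from Frobenius reciprocity, with a sum over group elements in place
    of double cosets. *)
Lemma cfdot_Ind_Ind (gT : finGroupType) (G A B : {group gT})
    (phi : 'CF(A)) (psi : 'CF(B)) : A \subset G -> B \subset G ->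
  '['Ind[G] phi, 'Ind[G] psi] =
    (#|A| * #|B|)%:R^-1 * \sum_(y in G) \sum_(c in B) phi (c ^ y)%g * (psi c)^*.
Proof.
move=> sAG sBG; rewrite -cfdot_Res_l cfdotE exchange_big /=.
rewrite natrM invfM [_^-1 * _^-1]mulrC -mulrA; congr (_ * _).
rewrite mulr_sumr; apply: eq_bigr => c Bc.
by rewrite cfResE // cfIndE // -mulr_suml mulrA.
Qed.

Section RowsColumns.
Variables (T : finType) (r q : T -> nat).
Let S := [set: {perm T}].
Implicit Types (y c : {perm T}).

(** The contribution of [y] to Mackey's formula. An odd element in the intersection of the column
    group with a conjugate of the row group makes it cancel; otherwise it is the order of that
    intersection. No two contributions can therefore cancel each other. *)
Let E y : algC := \sum_(c in young q) (1 : 'CF(young r)) (c ^ y)%g * (sgn_young q c)^*.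

Let EE y : E y = \sum_(c in young q | (c ^ y)%g \in young r) (-1) ^+ c.
Proof.
rewrite [RHS]big_mkcondr; apply: eq_bigr => c Cc.
rewrite cfun1E cfunE Cc mulr1n rmorph_sign.
by case: (_ \in _); rewrite ?mul1r ?mul0r.
Qed.

Let E_odd y d : d \in young q -> (d ^ y)%g \in young r -> odd_perm d -> E y = 0.
Proof.
move=> Cd Rd d_odd; have: E y = - E y.
  rewrite {1}EE (reindex_inj (mulIg d)) EE -sumrN; apply: eq_big => c.
    by rewrite conjMg (groupMr _ Cd) (groupMr _ Rd).
  by move=> _; rewrite odd_permM d_odd addbT signrN.
move/eqP; rewrite -subr_eq0 opprK -mulr2n -mulr_natl mulf_eq0 pnatr_eq0 /=.
by move/eqP.
Qed.

Let E_even y : (forall c, c \in young q -> (c ^ y)%g \in young r -> ~~ odd_perm c) ->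
  E y = #|[set c in young q | (c ^ y)%g \in young r]|%:R.
Proof.
move=> even; rewrite EE -sumr_const; apply: eq_big => c; first by rewrite inE.
by case/andP=> Cc Rc; rewrite (negPf (even c Cc Rc)).
Qed.

Let E_ge0 y : 0 <= E y.
Proof.
have [/existsP[d /and3P[Cd Rd od]]|] :=
    boolP [exists d, [&& d \in young q, (d ^ y)%g \in young r & odd_perm d]].
  by rewrite (E_odd Cd Rd).
rewrite negb_exists => /forallP even; rewrite E_even ?ler0n // => c Cc Rc.
by have := even c; rewrite Cc Rc.
Qed.

(** If distinct [a], [b] share a [q]-block and their images under [y] share an [r]-block, then
    [tperm a b] is an odd element of the intersection and [E y = 0]. *)
Lemma cfdot_row_col :
  '['Ind[S] (1 : 'CF(young r)), 'Ind[S] (sgn_young q)] != 0 ->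
  exists y, forall a b, q a = q b -> r (y a) = r (y b) -> a = b.
Proof.
rewrite cfdot_Ind_Ind ?subsetT // mulf_eq0 => /norP[_ nz].
have /exists_inP[y _ Ey]: [exists y in S, E y != 0].
  apply: contraNT nz; rewrite negb_exists_in => /forall_inP E0.
  by apply/eqP/big1 => y /E0; rewrite negbK => /eqP.
exists y => a b qab rab; apply/eqP; apply: contraNT Ey => neq_ab.
apply/eqP/(@E_odd y (tperm a b)); rewrite ?tpermJ ?odd_tperm // inE.
  by apply/forallP=> x; case: tpermP => // ->; rewrite qab.
by apply/forallP=> x; case: tpermP => // ->; rewrite rab.
Qed.

(** At [y = 1] the intersection is trivial, which gives a positive term, and all other terms are
    nonnegative. *)
Lemma cfdot_row_col_neq0 : (forall a b, q a = q b -> r a = r b -> a = b) ->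
  '['Ind[S] (1 : 'CF(young r)), 'Ind[S] (sgn_young q)] != 0.
Proof.
move=> rq_inj; rewrite cfdot_Ind_Ind ?subsetT // mulf_neq0 //.
  by rewrite invr_eq0 pnatr_eq0 -lt0n muln_gt0 !cardG_gt0.
have C1 c : c \in young q -> c \in young r -> c = 1%g.
  rewrite !inE => /forallP Cc /forallP Rc; apply/permP=> a; rewrite perm1.
  by apply: rq_inj; apply/eqP.
rewrite gt_eqF // (bigD1 1%g) ?inE //= ltr_pwDl //; last first.
  by apply: sumr_ge0 => y _; apply: E_ge0.
rewrite -/(E 1%g) E_even => [|c Cc]; last first.
  by rewrite conjg1 => Rc; rewrite (C1 c) ?odd_perm1.
by rewrite ltr0n card_gt0; apply/set0Pn; exists 1%g; rewrite inE conjg1 !group1.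
Qed.

End RowsColumns.

(** * Dominance order on partitions *)

Section Dominance.
Variable T : finType.
Implicit Types la mu : seq nat.

Lemma leq_sumn_take la i j : (i <= j)%N -> (sumn (take i la) <= sumn (take j la))%N.
Proof.
by move=> leij; rewrite -(cat_take_drop i (take j la)) take_takel // sumn_cat leq_addr.
Qed.

Lemma ltn_reshape_index la i k : (i < sumn la)%N ->
  (reshape_index la i < k)%N = (i < sumn (take k la))%N.
Proof.
move=> lt_i; set r := reshape_index la i.
have lt_r : (r < size la)%N by apply: reshape_indexP.
have lt_o := reshape_offsetP lt_i; have := reshape_indexK la i.
rewrite /flatten_index -/r => iE.
have [lt_rk | le_kr] := ltnP r k; apply/esym.
  apply: leq_trans (leq_sumn_take la lt_rk).
  by rewrite -iE (take_nth 0%N) // sumn_rcons ltn_add2l.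
by apply/negbTE; rewrite -leqNgt (leq_trans (leq_sumn_take la le_kr)) // -iE leq_addr.
Qed.

Lemma card_row_of_lt la k : sumn la = #|T| ->
  #|[set a : T | (row_of la a < k)%N]| = sumn (take k la).
Proof.
move=> laT; rewrite /row_of.
have le_m : (sumn (take k la) <= #|T|)%N.
  by rewrite -laT -{2}(cat_take_drop k la) sumn_cat leq_addr.
have -> : [set a : T | (reshape_index la (enum_rank a) < k)%N]
    = [set enum_val (widen_ord le_m i) | i in 'I_(sumn (take k la))].
  apply/setP=> a; rewrite inE ltn_reshape_index ?laT //.
  apply/idP/imsetP=> [lt_a | [i _ ->]]; last by rewrite enum_valK /=.
  by exists (Ordinal lt_a) => //; rewrite -[LHS]enum_rankK; congr enum_val; apply: val_inj.
rewrite card_imset ?card_ord // => i j /enum_val_inj/(congr1 val) /= eq_ij.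
exact: val_inj.
Qed.

(** In a column of [mu] of height [h], the map [rho] is injective, so at most the minimum of [k] and
    [h] points have [rho] below [k]. The first [k] rows of [mu] meet that column in exactly this
    many points; sum over the columns. *)
Lemma dominance la mu (rho : T -> nat) k : sumn la = #|T| -> sumn mu = #|T| ->
    sorted geq mu -> #|[set a | (rho a < k)%N]| = sumn (take k la) ->
    (forall a b, col_of mu a = col_of mu b -> rho a = rho b -> a = b) ->
  (sumn (take k la) <= sumn (take k mu))%N.
Proof.
move=> laT muT mu_sorted <- inj; rewrite -card_row_of_lt //.
pose cl (a : T) : 'I_#|T|.+1 := inord (col_of mu a).
have clE a : cl a = col_of mu a :> nat.
  rewrite inordK // ltnS; apply: leq_trans (ltnW (ltn_ord (enum_rank a))).
  exact: leq_subr.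
rewrite -!sum1_card (partition_big cl xpredT) //= [leqRHS](partition_big cl xpredT) //=.
apply: leq_sum => j _; rewrite !sum1_card.
(* Either column [j] misses some row [i < k], and then lies wholly above it because [mu] decreases,
   or it meets each of the first [k] rows. *)
have [/existsP[i /forallP ij]|] :=
    boolP [exists i : 'I_k, forall a, ~~ ((cl a == j) && (row_of mu a == i))].
  apply: subset_leq_card; apply/subsetP=> a /andP[_ aj].
  rewrite -topredE /= aj inE andbT.
  have mu_a : (col_of mu a < nth 0 mu (row_of mu a))%N.
    by apply: reshape_offsetP; rewrite muT.
  apply: leq_ltn_trans (ltn_ord i); rewrite leqNgt; apply/negP=> lt_ia.
  have mu_i : (col_of mu a < nth 0 mu i)%N.
    apply: leq_trans mu_a _; have geq_trans : transitive geq by move=> x y z xy /leq_trans; apply.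
    have [lt_r|] := ltnP (row_of mu a) (size mu); last by move=> ge; rewrite (nth_default _ ge).
    by apply: (sorted_ltn_nth geq_trans 0%N mu_sorted) => //; rewrite inE ?(ltn_trans lt_ia).
  have := flatten_indexP mu_i; rewrite [X in (_ < X)%N]muT => lt_f.
  have := ij (enum_val (Ordinal lt_f)); rewrite -val_eqE /= clE /row_of /col_of enum_valK /=.
  rewrite flatten_indexKl ?flatten_indexKr // eqxx andbT => /eqP[]; rewrite -(eqP aj).
  by rewrite clE.
rewrite negb_exists => /forallP full; apply: (@leq_trans k).
  have rhoP (a : {a | (rho a < k)%N && (cl a == j)}) : (rho (val a) < k)%N.
    by case: a => a /= /andP[].
  pose g (a : {a | (rho a < k)%N && (cl a == j)}) := Ordinal (rhoP a).
  have: injective g.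
    move=> [a /= aP] [b /= bP] /(congr1 val) /= eq_ab; apply: val_inj; apply: inj => //=.
    by case/andP: aP bP => _ /eqP aj /andP[_ /eqP bj]; rewrite -!clE aj bj.
  move/leq_card; rewrite card_ord card_sig => le_k; apply: leq_trans le_k.
    by apply/eq_leq/eq_card=> a; rewrite -!topredE /= !inE.
have ex (i : 'I_k) : exists a, (cl a == j) && (row_of mu a == i).
  by have := full i; rewrite negb_forall => /existsP[a]; rewrite negbK; exists a.
pose h i := xchoose (ex i).
have hP i : (cl (h i) == j) && (row_of mu (h i) == i) by apply: (xchooseP (ex i)).
have h_inj : injective h.
  move=> i i' eq_h; have /andP[_ /eqP hi] := hP i; have /andP[_ /eqP hi'] := hP i'.
  by apply: val_inj; rewrite /= -hi -hi' eq_h.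
rewrite -{1}(card_ord k) -(card_image h_inj); apply: subset_leq_card.
apply/subsetP=> _ /codomP[i ->]; have /andP[hj /eqP hi] := hP i.
by rewrite -topredE /= hj inE hi ltn_ord.
Qed.

Lemma take_sumn_inj la mu : size la = size mu ->
  (forall k, sumn (take k la) = sumn (take k mu)) -> la = mu.
Proof.
move=> eq_sz eq_sum; apply: (@eq_from_nth _ 0%N) => // i lt_i.
have := eq_sum i.+1; rewrite !(take_nth 0%N) -?eq_sz // !sumn_rcons eq_sum.
by move/addnI.
Qed.

End Dominance.

(** * Labelling of the irreducible characters by partitions *)

Section Labelling.
Variables (w : nat) (T : finType).
Let S := [set: {perm T}].
Implicit Types la mu : part w.

Lemma psize_le la : (psize la <= w)%N.
Proof. by have /andP[] := valP la. Qed.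

Lemma pseq_sorted la : sorted geq (pseq la).
Proof. by have /andP[] := valP la. Qed.

Lemma pseq_inj : injective (@pseq w).
Proof. by move=> la mu /(inj_map val_inj)/val_inj/val_inj. Qed.

Fact sgn_young_repr_subproof (q : T -> nat) :
  mx_repr (young q) (fun s : {perm T} => ((-1) ^+ s)%:M : 'M[algC]_1).
Proof.
split=> [|s t _ _]; first by rewrite odd_perm1.
by rewrite -scalar_mxM odd_permM signr_addb.
Qed.

Lemma sgn_young_char (q : T -> nat) : sgn_young q \is a character.
Proof.
have -> : sgn_young q = cfRepr (MxRepresentation (sgn_young_repr_subproof q)).
  by apply/cfunP=> s; rewrite !cfunE mxtrace_scalar.
exact: cfRepr_char.
Qed.

Definition common_constt (l : seq nat) (i : Iirr S) :=
  (i \in irr_constt ('Ind[S] (1 : 'CF(young (@row_of T l)))))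
  && (i \in irr_constt ('Ind[S] (sgn_young (@col_of T l)))).

Let row_char l : 'Ind[S] (1 : 'CF(young (@row_of T l))) \is a character.
Proof. by rewrite cfInd_char ?cfun1_char. Qed.

Let col_char l : 'Ind[S] (sgn_young (@col_of T l)) \is a character.
Proof. by rewrite cfInd_char ?sgn_young_char. Qed.

(** A shared constituent makes the inner product nonzero, so [cfdot_row_col] supplies a
    rearrangement of the rows of [la] to which [dominance] applies. *)
Lemma common_constt_dominance la mu i k : psize la = #|T| -> psize mu = #|T| ->
    i \in irr_constt ('Ind[S] (1 : 'CF(young (@row_of T (pseq la))))) ->
    i \in irr_constt ('Ind[S] (sgn_young (@col_of T (pseq mu)))) ->
  (sumn (take k (pseq la)) <= sumn (take k (pseq mu)))%N.
Proof.
move=> laT muT la_i mu_i.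
have /cfdot_row_col[y y_inj] : '['Ind[S] (1 : 'CF(young (@row_of T (pseq la)))),
    'Ind[S] (sgn_young (@col_of T (pseq mu)))] != 0.
  apply/eqP=> /(constt_ortho_char (row_char _) (col_char _) la_i mu_i)/eqP.
  by rewrite cfnorm_irr oner_eq0.
apply: (@dominance T _ _ (fun a => row_of (pseq la) (y a))) => //.
  exact: pseq_sorted.
rewrite -(card_row_of_lt k laT) -[RHS](card_preimset _ (@perm_inj _ y)).
by apply: eq_card => a; rewrite !inE.
Qed.

(** Each of [la] and [mu] dominates the other, hence all their partial sums agree. *)
Lemma common_constt_inj la mu i : psize la = #|T| -> psize mu = #|T| ->
  common_constt (pseq la) i -> common_constt (pseq mu) i -> la = mu.
Proof.
move=> laT muT /andP[la_r la_c] /andP[mu_r mu_c]; apply/pseq_inj/take_sumn_inj.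
  by rewrite !size_map !size_tuple.
by move=> k; apply/eqP; rewrite eqn_leq !(@common_constt_dominance _ _ i).
Qed.

(** A cell is determined by its row and column, so the two induced characters are not orthogonal.
    The default value in [chi_idx] is thus never reached. *)
Lemma chi_idxP la : psize la = #|T| -> common_constt (pseq la) (chi_idx T (pseq la)).
Proof.
move=> laT; rewrite /chi_idx; case: pickP => [i //| no_i] /=.
have /eqP[] : '['Ind[S] (1 : 'CF(young (@row_of T (pseq la)))),
    'Ind[S] (sgn_young (@col_of T (pseq la)))] != 0.
  apply: cfdot_row_col_neq0 => a b eq_c eq_r; apply/enum_rank_inj/val_inj.
  rewrite /= -(reshape_indexK (pseq la) (enum_rank a)) -/(row_of _ a) -/(col_of _ a).
  by rewrite eq_c eq_r reshape_indexK.
rewrite cfdot_sum_irr big1 // => i _; apply/eqP; rewrite mulf_eq0 conjC_eq0.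
have := no_i i; rewrite !irr_consttE.
by case: eqP => //= _ /negbT; rewrite negbK.
Qed.

Lemma chi_idx_inj : {in [pred la : part w | psize la == #|T|] &,
  injective (fun la => chi_idx T (pseq la))}.
Proof.
move=> la mu /eqP laT /eqP muT eq_idx.
by apply: (common_constt_inj laT muT (chi_idxP laT)); rewrite eq_idx chi_idxP.
Qed.

Hypothesis leTw : (#|T| <= w)%N.

(** An injective map from a set at least as large as its target is onto. *)
Lemma chi_idx_onto i : exists2 la : part w, psize la = #|T| & i = chi_idx T (pseq la).
Proof.
pose P := [set la : part w | psize la == #|T|].
have onto : [set chi_idx T (pseq la) | la in P] = setT.
  have le_P : (#|[set: Iirr S]| <= #|P|)%N.
    by rewrite cardsT card_ord NirrE card_classes_perm.
  apply/eqP; rewrite eqEcard subsetT card_in_imset // => la mu.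
  by rewrite !inE; apply: chi_idx_inj.
have : i \in [set chi_idx T (pseq la) | la in P] by rewrite onto inE.
by case/imsetP=> la; rewrite inE => /eqP laT ->; exists la.
Qed.

Lemma common_constt_uniq la i : psize la = #|T| ->
  common_constt (pseq la) i -> i = chi_idx T (pseq la).
Proof.
move=> laT la_i; have [mu muT iE] := chi_idx_onto i.
by rewrite (common_constt_inj laT muT la_i) // iE chi_idxP.
Qed.

Lemma big_chi_idx (R : Type) (idx : R) (op : Monoid.com_law idx) (F : Iirr S -> R) :
  \big[op/idx]_i F i =
    \big[op/idx]_(la : part w | psize la == #|T|) F (chi_idx T (pseq la)).
Proof.
rewrite [RHS](eq_bigl (fun la => la \in [set la : part w | psize la == #|T|])); last first.
  by move=> la; rewrite inE.
rewrite -(big_imset _ (h := fun la : part w => chi_idx T (pseq la))); last first.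
  by move=> la mu; rewrite !inE; apply: chi_idx_inj.
apply: eq_bigl => i; have [la laT ->] := chi_idx_onto i.
by apply/esym/imset_f; rewrite inE laT.
Qed.

End Labelling.

(** * Independence of the set being permuted *)

Section Transport.
Variables (T1 T2 : finType).

Section Isom.
Variables (f : T1 -> T2) (g : T2 -> T1) (fK : cancel f g) (gK : cancel g f).

Fact perm_transport_subproof (s : {perm T1}) : injective (fun b => f (s (g b))).
Proof. by move=> a b /(can_inj fK)/perm_inj/(can_inj gK). Qed.
Definition perm_transport s := perm (@perm_transport_subproof s).

Lemma perm_transportM : {in [set: {perm T1}] &, {morph perm_transport : s t / (s * t)%g}}.
Proof. by move=> s t _ _; apply/permP=> a; rewrite !(permM, permE) fK. Qed.
Canonical perm_transport_morphism := Morphism perm_transportM.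

Lemma perm_transport_isom : isom [set: {perm T1}] [set: {perm T2}] perm_transport.
Proof.
apply/isomP; split.
  apply/injmP=> s t _ _ /= eq_st; apply/permP=> a; apply: (can_inj fK).
  by have := congr1 (fun u : {perm T2} => u (f a)) eq_st; rewrite !permE fK.
apply/eqP; rewrite eqEsubset subsetT; apply/subsetP=> t _.
have s_inj : injective (fun a => g (t (f a))).
  by move=> a b /(can_inj gK)/perm_inj/(can_inj fK).
apply/morphimP; exists (perm s_inj); rewrite ?inE //.
by apply/permP=> b; rewrite /= !permE !gK.
Qed.

Lemma cfIsom_Ind_transport (A1 : {group {perm T1}}) (A2 : {group {perm T2}})
    (phi1 : 'CF(A1)) (phi2 : 'CF(A2)) :
    (forall s, (perm_transport s \in A2) = (s \in A1)) ->
    (forall s, phi2 (perm_transport s) = phi1 s) ->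
  cfIsom perm_transport_isom ('Ind phi1) = 'Ind phi2.
Proof.
have F_inj : injective perm_transport.
  have /isomP[/injmP F_inj _] := perm_transport_isom.
  by move=> s t; apply: F_inj; rewrite inE.
have F_onto t : exists s, t = perm_transport s.
  have /isomP[_ F_onto] := perm_transport_isom.
  have : t \in [set: {perm T2}] by rewrite inE.
  by rewrite -F_onto => /morphimP[s _ _ ->]; exists s.
move=> A12 phi12; apply/cfunP=> t; have [s ->] := F_onto t.
rewrite -[perm_transport s]/(perm_transport_morphism s) cfIsomE ?inE //.
have A2E : #|A2| = #|A1|.
  rewrite -(card_imset _ F_inj); apply: eq_card => u; have [v ->] := F_onto u.
  by rewrite A12 mem_imset.
rewrite !cfIndE ?subsetT // A2E; congr (_ * _).
rewrite [RHS](reindex_onto perm_transport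
  (fun t => odflt 1%g [pick s | t == perm_transport s])) /=; last first.
  move=> u _; case: pickP => [v /eqP //|]; have [v ->] := F_onto u.
  by move/(_ v); rewrite eqxx.
apply: eq_big => [z|z _]; last first.
  by rewrite -phi12; congr (phi2 _); apply: (morphJ perm_transport_morphism); rewrite inE.
rewrite !inE; case: pickP => [v /eqP/F_inj-> |/(_ z)]; last by rewrite eqxx.
by rewrite eqxx.
Qed.

End Isom.

(** The bijection [f0] that preserves enumeration ranks carries rows to rows and columns to columns,
    so the transported character is again the unique common constituent. The given [f] differs from
    [f0] by a permutation of [T2], and a class function does not see the difference. *)
Lemma chi_transport w (la : part w) (f : T1 -> T2) (s1 : {perm T1}) (s2 : {perm T2}) :
    bijective f -> psize la = #|T1| -> (forall a, s2 (f a) = f (s1 a)) ->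
  chi T2 (pseq la) s2 = chi T1 (pseq la) s1.
Proof.
move=> f_bij laT1 eq_s; have eqT := bij_eq_card f_bij.
pose f0 a := enum_val (cast_ord eqT (enum_rank a)) : T2.
pose g0 b := enum_val (cast_ord (esym eqT) (enum_rank b)) : T1.
have f0K : cancel f0 g0 by move=> a; rewrite /f0 /g0 enum_valK cast_ordK enum_rankK.
have g0K : cancel g0 f0 by move=> b; rewrite /f0 /g0 enum_valK cast_ordKV enum_rankK.
have laT2 : psize la = #|T2| by rewrite laT1.
have leT2 : (#|T2| <= w)%N by rewrite -laT2 psize_le.
pose iso := perm_transport_isom f0K g0K.
have chiE : cfIsom iso (chi T1 (pseq la)) = chi T2 (pseq la).
  have : cfIsom iso (chi T1 (pseq la)) \in irr [set: {perm T2}].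
    by rewrite cfIsom_irr mem_irr.
  case/irrP=> j jE; rewrite jE; congr 'chi_(_).
  apply: (@common_constt_uniq w) => //; have /andP[row_i col_i] := chi_idxP laT1.
  have rowE (a : T1) : row_of (pseq la) (f0 a) = row_of (pseq la) a.
    by rewrite /row_of /f0 enum_valK.
  have colE (a : T1) : col_of (pseq la) (f0 a) = col_of (pseq la) a.
    by rewrite /col_of /f0 enum_valK.
  have youngE (q1 : T1 -> nat) (q2 : T2 -> nat) s : (forall a, q2 (f0 a) = q1 a) ->
      (perm_transport f0K g0K s \in young q2) = (s \in young q1).
    move=> qE; rewrite !inE; apply/forallP/forallP=> Ys a.
      by have := Ys (f0 a); rewrite permE f0K !qE.
    by rewrite permE -{2}[a]g0K !qE Ys.
  have oddE s : odd_perm (perm_transport f0K g0K s) = odd_perm s.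
    have [ts -> _] := prod_tpermP s; elim: ts => [|[a b] ts IHts] /=.
      rewrite !big_nil odd_perm1.
      by have /= -> := morph1 (perm_transport_morphism f0K g0K); rewrite odd_perm1.
    rewrite !big_cons perm_transportM ?inE // !odd_permM IHts /=; congr (_ (+) _).
    rewrite [perm_transport _ _ _](_ : _ = tperm (f0 a) (f0 b)); last first.
      apply/permP=> c; rewrite permE /= (inj_tperm _ _ _ (can_inj f0K)) g0K //.
    by rewrite !odd_tperm (can_eq f0K).
  apply/andP; split; rewrite irr_consttE -jE.
    rewrite -(@cfIsom_Ind_transport _ _ f0K g0K _ _ (1 : 'CF(young (@row_of T1 (pseq la))))).
    - by rewrite cfIsom_iso -irr_consttE.
    - by move=> s; apply: youngE rowE.
    - by move=> s; rewrite !cfun1E (youngE (row_of (pseq la))).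
  rewrite -(@cfIsom_Ind_transport _ _ f0K g0K _ _ (sgn_young (@col_of T1 (pseq la)))).
  - by rewrite cfIsom_iso -irr_consttE.
  - by move=> s; apply: youngE colE.
  - by move=> s; rewrite !cfunE (youngE (col_of (pseq la))) // oddE.
have u_inj : injective (fun b => f (g0 b)).
  by move=> a b /(bij_inj f_bij)/(can_inj g0K).
rewrite -[s2](_ : (perm_transport f0K g0K s1 ^ perm u_inj)%g = _); last first.
  apply/permP=> b; rewrite -[b](permKV (perm u_inj)) permJ.
  by rewrite !permE f0K eq_s.
rewrite cfunJ ?inE // -chiE -[perm_transport _ _ s1]/(perm_transport_morphism f0K g0K s1).
by rewrite cfIsomE ?inE.
Qed.

End Transport.

(** * Characters of restrictions to stable subsets *)

Definition perm_stable (T : finType) (s : {perm T}) (A : {set T}) :=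
  s \in young (fun a => (a \in A) : nat).

Lemma perm_stableP (T : finType) (s : {perm T}) (A : {set T}) :
  reflect (forall a, (s a \in A) = (a \in A)) (perm_stable s A).
Proof.
rewrite /perm_stable inE; apply: (iffP forallP) => sA a.
  by have := sA a; case: (_ \in A) (_ \in A) => [] [].
by rewrite sA.
Qed.

Lemma perm_stable_emb (T1 T : finType) (f : T1 -> T) (s1 : {perm T1}) (s : {perm T})
    (A : {set T1}) : injective f -> (forall a, s (f a) = f (s1 a)) ->
  perm_stable s (f @: A) = perm_stable s1 A.
Proof.
move=> f_inj fs; apply/perm_stableP/perm_stableP=> sA a.
  by have := sA (f a); rewrite fs !mem_imset.
apply/imsetP/imsetP=> [[b Ab sab]|[b Ab ->]].
  exists ((s1^-1)%g b); first by rewrite -sA permKV.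
  by apply: (@perm_inj _ s); rewrite fs permKV.
by exists (s1 b); rewrite ?sA ?fs.
Qed.

Section ChiX.
Variables (w : nat) (T : finType).
Implicit Types (la : part w) (s : {perm T}) (A B : {set T}).

(* The value of chi_la at the restriction of s to A; it is 0 when s does not  *)
(* stabilise A or when la is not a partition of #|A|, so that sums over       *)
(* stable sets can be written as sums over all sets.                          *)
Definition chiX la s A : algC :=
  if perm_stable s A && (psize la == #|A|) then
    chi (blk (fun a => (a \in A) : nat) 1) (pseq la) (perm_blk (fun a => (a \in A) : nat) 1 s)
  else 0.

Lemma chiX_eq0 la s A : ~~ (perm_stable s A && (psize la == #|A|)) -> chiX la s A = 0.
Proof. by rewrite /chiX => /negPf->. Qed.

Lemma chiX_neq0 la s A : chiX la s A != 0 -> perm_stable s A /\ psize la = #|A|.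
Proof. by rewrite /chiX; case: andP => [[-> /eqP]|]; rewrite ?eqxx. Qed.

(** Lets [chiX] be computed in any coordinates on [A], in particular on a block of a Young
    subgroup. *)
Lemma chiX_emb (T1 : finType) (f : T1 -> T) (s1 : {perm T1}) la s A :
    injective f -> (forall a, s (f a) = f (s1 a)) -> f @: setT = A ->
    psize la = #|T1| ->
  chiX la s A = chi T1 (pseq la) s1.
Proof.
move=> f_inj fs defA laT1.
have As : perm_stable s A.
  by rewrite -defA (perm_stable_emb setT f_inj fs); apply/perm_stableP=> a; rewrite !inE.
have cardA : #|A| = #|T1| by rewrite -defA card_imset // cardsT.
rewrite /chiX As laT1 cardA eqxx /=.
have fA a : ((f a \in A) : nat) == 1%N by rewrite -defA imset_f ?inE.
apply: (chi_transport
  (f := fun a => exist _ (f a) (fA a) : blk (fun a => (a \in A) : nat) 1)) => //.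
  apply: inj_card_bij => [a b /(congr1 val) /f_inj // |].
  by rewrite -cardA card_sig leq_eqVlt; apply/orP; left; apply/eqP/eq_card=> a; rewrite !inE eqb1.
by move=> a; apply: val_inj; rewrite perm_blkE //=.
Qed.

Lemma perm_stableIU s A B : perm_stable s (A :&: B) -> perm_stable s (A :\: B) -> perm_stable s A.
Proof.
move=> /perm_stableP sI /perm_stableP sD; apply/perm_stableP=> a.
have := sI a; have := sD a; rewrite !inE.
by do 4!case: (_ \in _).
Qed.

End ChiX.

Lemma chiX_imset w (la : part w) (T1 T : finType) (f : T1 -> T)
    (s1 : {perm T1}) (s : {perm T}) (A : {set T1}) :
    injective f -> (forall a, s (f a) = f (s1 a)) ->
  chiX la s (f @: A) = chiX la s1 A.
Proof.
move=> f_inj fs; have cardA : #|f @: A| = #|A| by rewrite card_imset.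
have [|not] := boolP (perm_stable s1 A && (psize la == #|A|)); last first.
  by rewrite !chiX_eq0 // ?cardA ?(perm_stable_emb _ f_inj fs).
case/andP=> As /eqP laA; rewrite {2}/chiX As laA eqxx /=.
apply: (chiX_emb (f := fun a : blk (fun a => (a \in A) : nat) 1 => f (val a))).
- by move=> a b /f_inj/val_inj.
- by move=> a; rewrite fs perm_blkE.
- apply/setP=> b; apply/imsetP/imsetP=> [[a _ ->]|[a Aa ->]].
    by exists (val a) => //; have := valP a; rewrite eqb1.
  have a1 : ((a \in A) : nat) == 1%N by rewrite Aa.
  by exists (exist _ a a1).
- by rewrite laA card_sig; apply: eq_card => a; rewrite !inE eqb1.
Qed.

Lemma perm_pullback (T1 T : finType) (f : T1 -> T) (s : {perm T}) :
    injective f -> perm_stable s (f @: setT) ->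
  exists s1 : {perm T1}, forall a, s (f a) = f (s1 a).
Proof.
move=> f_inj /perm_stableP sf.
have ex a : exists b, s (f a) == f b.
  have : s (f a) \in f @: setT by rewrite sf imset_f ?inE.
  by case/imsetP=> b _ ->; exists b.
have exP a := eqP (xchooseP (ex a)).
have g_inj : injective (fun a => xchoose (ex a)).
  by move=> a b eq_ab; apply/f_inj/(@perm_inj _ s); rewrite !exP eq_ab.
by exists (perm g_inj) => a; rewrite permE.
Qed.

(** Fibres of equal size are matched through their enumerations. This yields both coset
    representatives with a prescribed colouring and coordinates adapted to a pair of sets. *)
Lemma matching (T1 T2 : finType) (L : eqType) (l1 : T1 -> L) (l2 : T2 -> L)
    (A : {set T2}) :
    (forall l, #|[set x | l1 x == l]| = #|[set a in A | l2 a == l]|) ->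
  exists h : T1 -> T2,
    [/\ injective h, h @: setT = A & forall x, l2 (h x) = l1 x].
Proof.
move=> eq_card12.
(* [nth] requires a default point of [T2], so the empty case is treated apart. *)
have [d _|T2_0] := pickP (predT : pred T2); last first.
  have T1_0 (x : T1) : False.
    have: x \in [set y | l1 y == l1 x] by rewrite inE.
    suff ->: [set y | l1 y == l1 x] = set0 by rewrite inE.
    apply/eqP; rewrite -cards_eq0 eq_card12 cards_eq0; apply/eqP/setP=> a.
    by have := T2_0 a.
  exists (fun x => match T1_0 x with end); split; try by move=> x; case: (T1_0 x).
  by apply/setP=> a; have := T2_0 a.
pose C1 l := enum [set x | l1 x == l]; pose C2 l := enum [set a in A | l2 a == l].
have sz l : size (C1 l) = size (C2 l) by rewrite -!cardE.
pose h x := nth d (C2 (l1 x)) (index x (C1 (l1 x))).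
have lt_h x : (index x (C1 (l1 x)) < size (C2 (l1 x)))%N.
  by rewrite -sz index_mem mem_enum inE.
have hP x : h x \in C2 (l1 x) by rewrite mem_nth.
have hA x : h x \in A by have := hP x; rewrite mem_enum inE => /andP[].
have hl x : l2 (h x) = l1 x by have := hP x; rewrite mem_enum inE => /andP[_ /eqP].
exists h; split=> // [x y eq_h|].
  have eq_l : l1 x = l1 y by rewrite -!hl eq_h.
  move/eqP: eq_h; rewrite /h eq_l nth_uniq ?enum_uniq //; last by rewrite -eq_l.
  by move=> /eqP/index_inj; apply; rewrite ?[_ \in C1 _]mem_enum ?inE ?eq_l.
apply/setP=> a; apply/imsetP/idP=> [[x _ ->] //|Aa].
have a2 : a \in C2 (l2 a) by rewrite mem_enum inE Aa eqxx.
have lt_a : (index a (C2 (l2 a)) < size (C1 (l2 a)))%N by rewrite sz index_mem.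
have [x0 _] : exists x0, x0 \in C1 (l2 a).
  by case: (C1 _) lt_a => // x0 ? _; exists x0; rewrite mem_head.
pose x := nth x0 (C1 (l2 a)) (index a (C2 (l2 a))).
have x1 : x \in C1 (l2 a) by rewrite mem_nth.
have xl : l1 x = l2 a by move: x1; rewrite mem_enum inE => /eqP.
by exists x; rewrite ?inE // /h xl /x index_uniq ?enum_uniq // nth_index.
Qed.

(** * Consecutive blocks and their labels *)

Section NatBlocks.
Variables (J : finType) (s : J -> nat) (n : nat).
Hypothesis sumE : (\sum_j s j)%N = n.

Let sumn_s : sumn [seq s j | j <- enum J] = n.
Proof. by rewrite sumnE big_map big_enum. Qed.

Lemma nat_blocks_lab (x : 'I_n) : exists j : J, nat_blocks s x == enum_rank j :> nat.
Proof.
have := @reshape_indexP [seq s j | j <- enum J] x; rewrite sumn_s ltn_ord.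
rewrite size_map -cardE => /(_ isT) lt_x.
by exists (enum_val (Ordinal lt_x)); rewrite enum_valK.
Qed.

Definition lab x : J := xchoose (nat_blocks_lab x).

Lemma labE x : nat_blocks s x = enum_rank (lab x) :> nat.
Proof. exact/eqP/(xchooseP (nat_blocks_lab x)). Qed.

Lemma nat_blocks_eq x j : (nat_blocks s x == enum_rank j :> nat) = (lab x == j).
Proof. by rewrite labE val_eqE (inj_eq enum_rank_inj). Qed.

Lemma young_lab (t : 'S_n) :
  (t \in young (@nat_blocks J s n)) = [forall x, lab (t x) == lab x].
Proof.
rewrite inE; apply: eq_forallb => x.
by rewrite !labE val_eqE (inj_eq enum_rank_inj).
Qed.

Lemma card_lab j : #|[set x | lab x == j]| = s j.
Proof.
pose l := [seq s j | j <- enum J].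
have s_j : nth 0%N l (enum_rank j) = s j.
  by rewrite (nth_map j) ?nth_enum_rank // -cardE.
rewrite -[RHS]card_ord -[RHS]cardsT.
pose g (i : 'I_(s j)) : nat := flatten_index l (enum_rank j) i.
have gP (i : 'I_(s j)) : (g i < n)%N.
  by rewrite -sumn_s flatten_indexP // s_j.
have -> : [set x | lab x == j] = [set Ordinal (gP i) | i in setT].
  apply/setP=> x; rewrite inE -nat_blocks_eq; apply/eqP/imsetP=> [xj|[i _ ->]].
    have lt_x : (x < sumn l)%N by rewrite sumn_s.
    have := reshape_offsetP lt_x.
    rewrite -[reshape_index l x]/(nat_blocks s x) xj s_j => lt_o.
    exists (Ordinal lt_o) => //; apply: val_inj; rewrite /= /g /=.
    by rewrite -[LHS](reshape_indexK l x) -[X in flatten_index _ X _]/(nat_blocks s x) xj.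
  by rewrite /nat_blocks /= flatten_indexKl // s_j.
rewrite card_imset // => i k /(congr1 val) /= /addnI eq_ik; exact: val_inj.
Qed.

End NatBlocks.

Lemma eq_nat_blocks (J : finType) (s s' : J -> nat) n : s =1 s' ->
  @nat_blocks J s n = @nat_blocks J s' n.
Proof. by move=> /eq_map eq_s; rewrite /nat_blocks eq_s. Qed.

(** Here [q] names the left cosets of [K] by elements of [Om]. The summand of an induced character
    is constant on each coset, whose [#|K|] elements cancel the factor in front; names of no coset
    contribute zero. *)
Lemma cfInd_fibres (gT : finGroupType) (G K : {group gT}) (phi : 'CF(K))
    (Om : finType) (q : gT -> Om) (V : Om -> algC) (x : gT) :
    K \subset G ->
    {in G &, forall y z, (q y == q z) = ((y^-1 * z)%g \in K)} ->
    {in G, forall y, phi (x ^ y)%g = V (q y)} ->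
    (forall o, V o != 0 -> exists2 y, y \in G & q y = o) ->
  'Ind[G] phi x = \sum_o V o.
Proof.
move=> sKG qE phiE V0; rewrite cfIndE //.
rewrite (partition_big q xpredT) //= mulr_sumr; apply: eq_bigr => o _.
have [/exists_inP[z Gz /eqP zo]|no] := boolP [exists z in G, q z == o]; last first.
  have /eqP->: V o == 0.
    apply: contraNT no => /V0[y Gy yo]; apply/exists_inP.
    by exists y; rewrite ?yo.
  rewrite big1 ?mulr0 // => y /andP[Gy yo]; case/negP: no.
  by apply/exists_inP; exists y.
rewrite (eq_bigr (fun=> V o)); last by move=> y /andP[Gy /eqP <-]; apply: phiE.
rewrite sumr_const (_ : #|_| = #|K|).
  by rewrite -[V o *+ _]mulr_natl mulrA mulVf ?mul1r // neq0CG.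
rewrite -(card_lcoset K z); apply: eq_card => y; rewrite mem_lcoset -topredE /= -zo.
have [Gy|nGy] := boolP (y \in G); first by rewrite eq_sym qE.
apply/esym/negbTE; apply: contra nGy => /(subsetP sKG).
by rewrite groupMl ?groupV.
Qed.

(** * Littlewood-Richardson expansion of a restriction *)

(** Column orthogonality: the conjugating elements, if any, form a coset of a centraliser. *)
Lemma sum_irr_conj (gT : finGroupType) (G : {group gT}) u v :
    u \in G -> v \in G ->
  \sum_i 'chi[G]_i u * ('chi_i v)^* = #|[set z in G | (u ^ z)%g == v]|%:R.
Proof.
move=> Gu Gv; rewrite second_orthogonality_relation //.
have [/imsetP[z Gz uvz]|not] := boolP (u \in v ^: G); last first.
  rewrite mulr0n (_ : [set z in G | (u ^ z)%g == v] = set0) ?cards0 //.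
  apply/setP=> z; rewrite !inE; apply/negbTE; apply: contra not.
  by case/andP=> Gz /eqP <-; rewrite class_sym memJ_class.
rewrite mulr1n -(card_rcoset _ (z^-1)%g); congr (_%:R).
apply: eq_card => y; rewrite mem_rcoset invgK !inE.
rewrite groupMr // -(inj_eq (@conjg_inj _ z)) -conjgM uvz; congr (_ && _).
by rewrite conjg_set1 sub1set inE.
Qed.

Section TwoBlocks.
Variables (w : nat) (T : finType) (b : T -> nat) (k1 k2 : nat).
Hypotheses (neq_k : k1 != k2) (b12 : forall x, (b x == k1) || (b x == k2)).
Hypothesis leTw : (#|T| <= w)%N.

Let z1 (z : {perm T}) := perm_blk b k1 z.
Let z2 (z : {perm T}) := perm_blk b k2 z.

Lemma perm_blkJ k s z : s \in young b -> z \in young b ->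
  perm_blk b k (s ^ z)%g = (perm_blk b k s ^ perm_blk b k z)%g.
Proof. by move=> Ys Yz; rewrite morphJ ?(subsetP (young_sub_dom b k)). Qed.

Lemma perm_blk2_inj : {in young b &, forall s t, z1 s = z1 t -> z2 s = z2 t -> s = t}.
Proof.
move=> s t Ys Yt eq1 eq2; apply/permP=> x; have /orP[bx|bx] := b12 x.
  by have := congr1 (fun u : {perm blk b k1} => val (u (exist _ x bx))) eq1; rewrite !perm_blkE.
by have := congr1 (fun u : {perm blk b k2} => val (u (exist _ x bx))) eq2; rewrite !perm_blkE.
Qed.

Lemma perm_blk2_onto u1 u2 : exists2 s, s \in young b & z1 s = u1 /\ z2 s = u2.
Proof.
pose f x := if insub x is Some a then val (u1 (a : blk b k1))
            else if insub x is Some a then val (u2 (a : blk b k2)) else x.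
have f1 (a : blk b k1) : f (val a) = val (u1 a) by rewrite /f valK.
have f2 (a : blk b k2) : f (val a) = val (u2 a).
  rewrite /f insubN ?valK //; have /eqP-> := valP a.
  by rewrite eq_sym.
have bf x : b (f x) = b x.
  have /orP[bx|bx] := b12 x.
    have := f1 (exist _ x bx); rewrite /= => ->.
    by rewrite (eqP bx); apply/eqP/(valP (u1 _)).
  have := f2 (exist _ x bx); rewrite /= => ->.
  by rewrite (eqP bx); apply/eqP/(valP (u2 _)).
have f_inj : injective f.
  move=> x y eq_f; have eq_b : b x = b y by rewrite -(bf x) eq_f bf.
  have /orP[bx|bx] := b12 x.
    have ybx : b y == k1 by rewrite -eq_b.
    have := f1 (exist _ x bx); have := f1 (exist _ y ybx); rewrite /= eq_f => ->.
    by move/val_inj/perm_inj => [].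
  have ybx : b y == k2 by rewrite -eq_b.
  have := f2 (exist _ x bx); have := f2 (exist _ y ybx); rewrite /= eq_f => ->.
  by move/val_inj/perm_inj => [].
have Ys : perm f_inj \in young b.
  by rewrite inE; apply/forallP=> x; rewrite permE bf.
exists (perm f_inj) => //; split; apply/permP=> a; apply: val_inj.
  by rewrite perm_blkE // permE f1.
by rewrite perm_blkE // permE f2.
Qed.

Lemma card_conj_blk2 s t : s \in young b -> t \in young b ->
  #|[set z in young b | (s ^ z)%g == t]| =
    (#|[set z in [set: {perm blk b k1}] | (z1 s ^ z)%g == z1 t]|
     * #|[set z in [set: {perm blk b k2}] | (z2 s ^ z)%g == z2 t]|)%N.
Proof.
move=> Ys Yt; rewrite -cardsX.
rewrite -(@card_in_imset _ _ (fun z => (z1 z, z2 z))); last first.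
  move=> y z; rewrite in_set => /andP[Yy _]; rewrite in_set => /andP[Yz _] [].
  exact: perm_blk2_inj.
apply: eq_card => -[u1 u2]; rewrite !inE /=.
apply/imsetP/andP=> [[z] |[/eqP eq1 /eqP eq2]].
  rewrite in_set => /andP[Yz /eqP <-] [-> ->].
  by rewrite /z1 /z2 !perm_blkJ.
have [z Yz [zu1 zu2]] := perm_blk2_onto u1 u2; exists z; last by rewrite zu1 zu2.
rewrite in_set Yz; apply/eqP/perm_blk2_inj; rewrite ?groupJ //.
  by rewrite /z1 perm_blkJ // -/(z1 z) zu1.
by rewrite /z2 perm_blkJ // -/(z2 z) zu2.
Qed.

(** Expansion of a class function in outer products. Column orthogonality on the two blocks counts
    the elements of [young b] conjugating [s] to [t], so the double sum becomes the average of [f]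
    over conjugates of [s]. *)
Lemma cfun_young2_sum (f : 'CF(young b)) (out : part w -> part w -> 'CF(young b)) s :
    (forall be ga t, t \in young b ->
       out be ga t = chi (blk b k1) (pseq be) (z1 t) * chi (blk b k2) (pseq ga) (z2 t)) ->
    s \in young b ->
  f s = \sum_(be : part w | psize be == #|blk b k1|)
          \sum_(ga : part w | psize ga == #|blk b k2|) '[f, out be ga] * out be ga s.
Proof.
move=> outE Ys.
have leb k : (#|blk b k| <= w)%N by rewrite (leq_trans _ leTw) // card_sig max_card.
transitivity (\sum_(be : part w | psize be == #|blk b k1|)
          \sum_(ga : part w | psize ga == #|blk b k2|)
      \sum_(t in young b) #|young b|%:R^-1 * (f t *
        ((chi (blk b k1) (pseq be) (z1 s) * (chi (blk b k1) (pseq be) (z1 t))^*) *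
         (chi (blk b k2) (pseq ga) (z2 s) * (chi (blk b k2) (pseq ga) (z2 t))^*)))); last first.
  apply: eq_bigr => be _; apply: eq_bigr => ga _.
  rewrite cfdotE -mulrA mulr_suml mulr_sumr; apply: eq_bigr => t Yt.
  rewrite !outE // -[in RHS]mulrA; congr (_ * (_ * _)).
  by rewrite mulrACA mulrC rmorphM.
under eq_bigr => be _ do rewrite exchange_big /=.
rewrite exchange_big /=.
under eq_bigr => t Yt.
  under eq_bigr => be _ do rewrite -mulr_sumr -mulr_sumr -mulr_sumr.
  rewrite -mulr_sumr -mulr_sumr -mulr_suml.
  rewrite -(@big_chi_idx w _ (leb k1) _ _ _ (fun i => 'chi_i (z1 s) * ('chi_i (z1 t))^*)).
  rewrite -(@big_chi_idx w _ (leb k2) _ _ _ (fun i => 'chi_i (z2 s) * ('chi_i (z2 t))^*)).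
  rewrite !sum_irr_conj ?inE // -natrM -card_conj_blk2 //.
  over.
rewrite -mulr_sumr /=.
transitivity (#|young b|%:R^-1 * \sum_(z in young b) f (s ^ z)%g).
  rewrite (eq_bigr (fun=> f s)) => [|z Yz]; last by rewrite cfunJ.
  by rewrite sumr_const -[f s *+ _]mulr_natl mulrA mulVf ?mul1r ?neq0CG.
congr (_ * _); rewrite (partition_big (fun z => s ^ z)%g (fun t => t \in young b)) /=; last first.
  by move=> z Yz; exact: (groupJ Ys Yz).
apply: eq_bigr => t Yt.
rewrite (eq_bigr (fun=> f t)) => [|z /andP[_ /eqP->] //].
rewrite sumr_const -[LHS]mulr_natr; congr (_ * _%:R); apply: eq_card => z.
by rewrite in_set.
Qed.

End TwoBlocks.

Section OuterProduct.
Variables (J T : finType) (b : T -> nat).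

Definition outer_blk (mu : J -> seq nat) : 'CF(young b) :=
  \prod_j cfMorph ('Res[perm_blk b (enum_rank j) @* young b]
                     (chi (blk b (enum_rank j)) (mu j))).

Lemma outer_blkE mu s : s \in young b ->
  outer_blk mu s =
    \prod_j chi (blk b (enum_rank j)) (mu j) (perm_blk b (enum_rank j) s).
Proof.
move=> Ys; rewrite prod_cfunE //; apply: eq_bigr => j _.
rewrite cfMorphE ?young_sub_dom // cfResE ?subsetT //.
by rewrite mem_morphim ?(subsetP (young_sub_dom _ _)).
Qed.

Lemma outer_blk_char mu : outer_blk mu \is a character.
Proof. by apply: rpred_prod => j _; rewrite cfMorph_char ?cfRes_char ?irr_char. Qed.

End OuterProduct.

Lemma LR2E w (al be ga : part w) (s0 : bool -> nat) (n : nat)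
    (mu := fun j : bool => if j then pseq be else pseq ga) (b := @nat_blocks bool s0 n) :
    psize al = n -> psize be = s0 true -> psize ga = s0 false ->
  LR2 al be ga = '['Res[young b] (chi 'I_n (pseq al)), outer_blk b mu].
Proof.
rewrite /b => <- be_n ga_n {b}.
rewrite (@eq_nat_blocks _ s0 (sumn \o mu)) //.
by case=> /=; rewrite ?be_n ?ga_n.
Qed.

Section LRExpansion.
Variables (w : nat) (T : finType).
Implicit Types (s : {perm T}) (A B : {set T}).

(** In coordinates where [A :&: B] and [A :\: B] are consecutive blocks, [s] lies in a Young
    subgroup, and the restriction of [chi] expands with the coefficients [LR2]. *)
Lemma chiX_LR2 (al : part w) s A B : perm_stable s B ->
  chiX al s A =
    \sum_(be : part w) \sum_(ga : part w | (psize be + psize ga == psize al)%N)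
      LR2 al be ga * (chiX be s (A :&: B) * chiX ga s (A :\: B)).
Proof.
move=> sB; have cardA := cardsID B A.
have [|not] := boolP (perm_stable s A && (psize al == #|A|)); last first.
  rewrite chiX_eq0 // big1 // => be _; apply: big1 => ga /eqP al_sz.
  apply/eqP; apply: contraNT not; rewrite !mulf_eq0 !negb_or => /and3P[_].
  move=> /chiX_neq0[sI szI] /chiX_neq0[sD szD].
  by rewrite (perm_stableIU sI sD) -al_sz szI szD cardA eqxx.
case/andP=> sA /eqP alA; set n := psize al in alA.
(* The part inside [B] is the block [true], which comes first in the enumeration of [bool], as in
   [LR2]. *)
pose s0 (j : bool) := if j then #|A :&: B| else #|A :\: B|.
have sum_s0 : (\sum_j s0 j)%N = n by rewrite big_bool /= cardA alA.
pose b := @nat_blocks bool s0 n.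
have [|h [h_inj hA hB]] := @matching _ T _ (lab sum_s0) (fun a => a \in B) A.
  move=> j; rewrite card_lab /s0; case: j; apply: eq_card => a; rewrite !inE.
    by rewrite eqb_id.
  by rewrite eqbF_neg andbC.
have [|s1 hs] := perm_pullback (f := h) (s := s) h_inj; first by rewrite hA.
have Ys1 : s1 \in young b.
  rewrite young_lab; apply/forallP=> x; rewrite -!hB -hs.
  by move/perm_stableP: sB => ->.
rewrite (chiX_emb (f := h) (s1 := s1)) ?card_ord //.
have bE x j : (b x == enum_rank j :> nat) = ((h x \in B) == j).
  by rewrite nat_blocks_eq hB.
pose mu (be ga : part w) := fun j : bool => if j then pseq be else pseq ga.
have neq_k : enum_rank true != enum_rank false :> nat.
  by rewrite val_eqE (inj_eq enum_rank_inj).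
have b12 x : (b x == enum_rank true) || (b x == enum_rank false).
  by rewrite !bE; case: (_ \in B).
have le_n : (#|'I_n| <= w)%N by rewrite card_ord psize_le.
have outE (be ga : part w) t : t \in young b -> outer_blk b (mu be ga) t =
    chi (blk b (enum_rank true)) (pseq be) (perm_blk b (enum_rank true) t)
    * chi (blk b (enum_rank false)) (pseq ga) (perm_blk b (enum_rank false) t).
  by move=> Yt; rewrite outer_blkE // big_bool.
have -> : chi 'I_n (pseq al) s1 = 'Res[young b] (chi 'I_n (pseq al)) s1.
  by rewrite cfResE ?subsetT.
rewrite (cfun_young2_sum neq_k b12 le_n _ outE Ys1).
have imE j : [set h (val x) | x in [set: blk b (enum_rank j)]] = [set a in A | (a \in B) == j].
  apply/setP=> a; rewrite inE -hA; apply/imsetP/andP=> [[x _ ->]|[/imsetP[x _ ->]]].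
    by rewrite imset_f ?inE // -bE (valP x).
  by rewrite -bE => bx; exists (exist _ x bx); rewrite ?inE.
have im1 : [set h (val x) | x in [set: blk b (enum_rank true)]] = A :&: B.
  by rewrite imE; apply/setP=> a; rewrite !inE; case: (a \in B).
have im2 : [set h (val x) | x in [set: blk b (enum_rank false)]] = A :\: B.
  by rewrite imE; apply/setP=> a; rewrite !inE andbC; case: (a \in B).
have hv_inj (j : bool) : injective (fun x : blk b (enum_rank j) => h (val x)).
  by move=> x y /h_inj/val_inj.
have card1 : #|blk b (enum_rank true)| = #|A :&: B|.
  by rewrite -im1 (card_imset _ (@hv_inj _)) cardsT.
have card2 : #|blk b (enum_rank false)| = #|A :\: B|.
  by rewrite -im2 (card_imset _ (@hv_inj _)) cardsT.
rewrite card1 card2 big_mkcond /=; apply: eq_bigr => be _.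
have [beI|neI] := eqVneq (psize be) #|A :&: B|; last first.
  rewrite big1 // => ga _; rewrite [X in _ * (X * _)]chiX_eq0 ?mul0r ?mulr0 //.
  by rewrite (negPf neI) andbF.
rewrite [RHS](bigID (fun ga : part w => psize ga == #|A :\: B|)) /=.
rewrite [X in _ + X]big1 ?addr0 => [|ga /andP[_ neD]]; last first.
  by rewrite [X in _ * (_ * X)]chiX_eq0 ?mulr0 // (negPf neD) andbF.
apply: eq_big => [ga | ga /eqP gaD].
  by rewrite beI -/n alA -cardA eqn_add2l andbb.
rewrite (@LR2E _ al be ga s0 n) //; congr (_ * _); rewrite outE //.
congr (_ * _); apply/esym.
  apply: (chiX_emb (f := fun x : blk b (enum_rank true) => h (val x))) => //.
    by move=> x; rewrite hs perm_blkE.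
  by rewrite beI card1.
apply: (chiX_emb (f := fun x : blk b (enum_rank false) => h (val x))) => //.
  by move=> x; rewrite hs perm_blkE.
by rewrite gaD card2.
Qed.

End LRExpansion.

(** * Induction from Young subgroups as a sum over colourings *)

Section Colourings.
Variables (w n : nat) (J : finType) (la : J -> part w).
Hypothesis la_n : (\sum_j psize (la j))%N = n.

Lemma colouring_onto (c : 'I_n -> J) :
    (forall j, psize (la j) = #|[set a | c a == j]|) ->
  exists y : 'S_n, forall a, lab la_n (y a) = c a.
Proof.
move=> c_la; have [|h [h_inj _ hc]] := @matching _ _ _ c (lab la_n) setT.
  by move=> j; rewrite -c_la -(card_lab la_n); apply: eq_card => a; rewrite !inE.
by exists (perm h_inj) => a; rewrite permE hc.
Qed.

(** Cosets of the Young subgroup are the colourings with prescribed class sizes; [chiX] vanishes for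
    all other colourings and for those not stable under [s]. *)
Lemma cfInd_young_colourings (s : 'S_n) :
  'Ind[[set: 'S_n]] (chi_outer (fun j => pseq (la j)) n) s =
    \sum_(c : {ffun 'I_n -> J}) \prod_j chiX (la j) s [set a | c a == j].
Proof.
pose q (y : 'S_n) : {ffun 'I_n -> J} := [ffun a => lab la_n (y a)].
apply: (cfInd_fibres (q := q)); first exact: subsetT.
- move=> y z _ _; rewrite -[young_type _ _]/(young (@nat_blocks J (fun j => psize (la j)) n)).
  rewrite (young_lab la_n).
  apply/eqP/forallP=> [eq_q a|yz].
    have := congr1 (fun c : {ffun 'I_n -> J} => c ((y^-1)%g a)) eq_q.
    by rewrite !ffunE permKV permM => ->.
  apply/ffunP=> a; have := yz (y a); rewrite permM permK !ffunE.
  by move/eqP.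
- move=> y _; pose b := @nat_blocks J (fun j => psize (la j)) n.
  have [Ys|nYs] := boolP ((s ^ y)%g \in young b).
    rewrite -[chi_outer _ _]/(outer_blk b (fun j => pseq (la j))) outer_blkE //.
    apply: eq_bigr => j _; apply/esym.
    apply: (chiX_emb (f := fun x : blk b (enum_rank j) => (y^-1)%g (val x))).
    + by move=> x x' /perm_inj/val_inj.
    + move=> x; rewrite perm_blkE //; apply: (@perm_inj _ y).
      by rewrite permKV -permJ permKV.
    + apply/setP=> a; rewrite inE ffunE -nat_blocks_eq; apply/imsetP/idP=> [[x _ ->]|ya].
        by rewrite permKV; apply: (valP x).
      by exists (exist _ (y a) ya); rewrite ?inE ?permK.
    rewrite -(card_lab la_n j) card_sig; apply: eq_card => x.
    by rewrite !inE -nat_blocks_eq.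
  rewrite cfun0gen ?genGid //; apply/esym/eqP.
  apply: contraNT nYs => /prodf_neq0 nz; rewrite (young_lab la_n); apply/forallP=> a.
  have /chiX_neq0[/perm_stableP/(_ ((y^-1)%g a)) + _] := nz (lab la_n a) isT.
  rewrite !inE !ffunE permKV eqxx => /eqP <-.
  by rewrite -permJ permKV.
- move=> c /prodf_neq0 nz; have [|y yc] := @colouring_onto c.
    by move=> j; have /chiX_neq0[] := nz j isT.
  by exists y; rewrite ?inE //; apply/ffunP=> a; rewrite ffunE yc.
Qed.

End Colourings.

Lemma LRfamE w (J : finType) (ga : part w) (be : J -> part w) m : psize ga = m ->
  LRfam ga be = '['Ind[[set: 'S_m]] (chi_outer (fun j => pseq (be j)) m), chi 'I_m (pseq ga)].
Proof.
move=> <-; rewrite /LRfam cfdotC_char ?irr_char // cfInd_char //.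
exact: outer_blk_char.
Qed.

Lemma perm_stable_cover (T J : finType) (s : {perm T}) (c : {ffun T -> J})
    (B : {set T}) :
  (forall j, perm_stable s (B :&: [set a | c a == j])) -> perm_stable s B.
Proof.
move=> sB; apply/perm_stableP=> a; apply/idP/idP=> Ba.
  have /perm_stableP/(_ a) := sB (c (s a)).
  by rewrite !inE Ba eqxx => /esym/andP[].
have /perm_stableP/(_ a) := sB (c a).
by rewrite !inE Ba eqxx => /andP[].
Qed.

(** Both sides are the value on [B] of the character induced from the outer product of the [chi] of
    the [be j]: one decomposed into irreducibles, the other written over colourings. Freezing [c] to
    [c0] outside [B] counts each colouring of [B] once. *)
Lemma sum_LRfam w (T J : finType) (be : J -> part w) (s : {perm T}) (B : {set T})
    (c0 : T -> J) : (\sum_j psize (be j) <= w)%N ->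
  \sum_(ga : part w | psize ga == (\sum_j psize (be j))%N) LRfam ga be * chiX ga s B =
  \sum_(c : {ffun T -> J} | [forall a, (a \notin B) ==> (c a == c0 a)])
    \prod_j chiX (be j) s (B :&: [set a | c a == j]).
Proof.
set m := (\sum_j _)%N => le_m.
have [|not] := boolP (perm_stable s B && (m == #|B|)); last first.
  rewrite big1 => [|ga /eqP gam]; last by rewrite chiX_eq0 ?mulr0 // gam.
  rewrite big1 // => c _; apply/eqP; apply: contraNT not => /prodf_neq0 nz.
  have sb j : perm_stable s (B :&: [set a | c a == j]) by have /chiX_neq0[] := nz j isT.
  apply/andP; split.
    exact: (@perm_stable_cover _ _ _ c).
  rewrite /m -sum1_card (partition_big c xpredT) //=; apply/eqP/eq_bigr => j _.
  have /chiX_neq0[_ ->] := nz j isT; rewrite sum1_card.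
  by apply: eq_card => a; rewrite !inE.
case/andP=> sB /eqP mB.
pose h (x : 'I_m) : T := enum_val (cast_ord mB x).
have h_inj : injective h by move=> x y /enum_val_inj/cast_ord_inj.
have hB : h @: setT = B.
  apply/setP=> a; apply/imsetP/idP=> [[x _ ->]|Ba]; first exact: enum_valP.
  exists (cast_ord (esym mB) (enum_rank_in Ba a)) => //.
  by rewrite /h cast_ordKV enum_rankK_in.
have [|s1 hs] := perm_pullback (f := h) (s := s) h_inj; first by rewrite hB.
have leI : (#|'I_m| <= w)%N by rewrite card_ord.
transitivity ('Ind[[set: 'S_m]] (chi_outer (fun j => pseq (be j)) m) s1).
  rewrite ['Ind _]cfun_sum_cfdot sum_cfunE (big_chi_idx leI) card_ord.
  apply: eq_bigr => ga /eqP gam; rewrite cfunE (LRfamE _ gam).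
  by rewrite (chiX_emb (f := h) (s1 := s1)) // card_ord.
rewrite (cfInd_young_colourings (erefl m)).
pose restr (c : {ffun T -> J}) : {ffun 'I_m -> J} := [ffun x => c (h x)].
pose ext (c : {ffun 'I_m -> J}) : {ffun T -> J} :=
  [ffun a => if [pick x | h x == a] is Some x then c x else c0 a].
have extK : cancel ext restr.
  move=> c; apply/ffunP=> x; rewrite !ffunE; case: pickP => [y /eqP/h_inj-> //|].
  by move/(_ x); rewrite eqxx.
rewrite [RHS](reindex_onto ext restr) /=; last first.
  move=> c /forall_inP c_c0; apply/ffunP=> a; rewrite !ffunE.
  case: pickP => [x /eqP <-|no]; first by rewrite ffunE.
  apply/esym/eqP/c_c0; rewrite -hB; apply/imsetP=> -[x _ ax].
  by have := no x; rewrite ax eqxx.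
apply/esym/eq_big => c; first rewrite extK eqxx andbT.
  apply/forall_inP=> a; rewrite ffunE; case: pickP => // x /eqP <-.
  by rewrite -hB imset_f ?inE.
move=> _; apply: eq_bigr => j _; rewrite -(chiX_imset _ _ h_inj hs); congr chiX.
have extE x : ext c (h x) = c x by rewrite -[in RHS](extK c) [RHS]ffunE.
apply/setP=> a; rewrite !inE; apply/andP/imsetP=> [[]|[x + ->]].
  by rewrite -hB => /imsetP[x _ ->]; rewrite extE => cx; exists x; rewrite ?inE.
by rewrite inE extE -hB imset_f ?inE.
Qed.

(** * Characters of wreath products as sums over colourings *)

(* A chosen point in each cycle of s, the same as in tilde_fun. *)
Definition is_rep (T : finType) (s : {perm T}) (a : T) :=
  [pick i in porbit s a] == Some a.

Lemma is_rep_ex (T : finType) (s : {perm T}) (a : T) :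
  exists2 b, b \in porbit s a & is_rep s b.
Proof.
case E: [pick i in porbit s a] => [b|]; last first.
  by move: E; case: pickP => // /(_ a); rewrite porbit_id.
have ba : b \in porbit s a by move: E; case: pickP => // c ca [<-].
exists b => //; rewrite /is_rep; have /eqP-> : porbit s b == porbit s a.
  by rewrite eq_porbit_mem.
exact/eqP.
Qed.

Lemma is_rep_inj (T : finType) (s : {perm T}) (a b : T) :
  is_rep s a -> is_rep s b -> b \in porbit s a -> a = b.
Proof.
rewrite -eq_porbit_mem => /eqP a_rep /eqP b_rep /eqP eq_ba.
by move: b_rep; rewrite eq_ba a_rep => -[].
Qed.

Lemma expg_emb (T1 T : finType) (f : T1 -> T) (s1 : {perm T1}) (s : {perm T}) :
    (forall a, s (f a) = f (s1 a)) ->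
  forall n a, (s ^+ n)%g (f a) = f ((s1 ^+ n)%g a).
Proof. by move=> fs n a; rewrite !permX; elim: n => //= n ->. Qed.

Lemma porbit_emb (T1 T : finType) (f : T1 -> T) (s1 : {perm T1}) (s : {perm T}) :
    (forall a, s (f a) = f (s1 a)) ->
  forall a, porbit s (f a) = f @: porbit s1 a.
Proof.
move=> fs a; apply/setP=> b; apply/porbitP/imsetP=> [[n ->]|[c /porbitP[n ->] ->]].
  by exists ((s1 ^+ n)%g a); rewrite ?mem_porbit // (expg_emb fs).
by exists n; rewrite (expg_emb fs).
Qed.

Section TildeEmbedding.
Variables (gT : finGroupType) (N : {group gT}) (T1 T : finType).
Variables (f : T1 -> T) (x1 : wreath gT T1) (x : wreath gT T) (h : T1 -> gT).
Hypotheses (f_inj : injective f) (Nx : x \in wr T N).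
Hypothesis hN : forall a, h a \in N.
Hypothesis fx : forall a, wperm x (f a) = f (wperm x1 a).
Hypothesis base_x1 : forall a,
  wbase x1 a = ((h a)^-1 * wbase x (f a) * h (((wperm x1)^-1)%g a))%g.

(** [x1] is the restriction along [f] of a conjugate of [x] by a base element [h], so the factors of
    [h] telescope around the cycle. *)
Lemma cycprod_emb a : cycprod x1 a = (cycprod x (f a) ^ h a)%g.
Proof.
have fxV m b : f ((wperm x1 ^- m)%g b) = (wperm x ^- m)%g (f b).
  by apply: (@perm_inj _ (wperm x ^+ m)%g); rewrite (expg_emb fx) !permKV.
rewrite /cycprod (porbit_emb fx) card_imset //; set n := #|_|.
pose g m := wbase x ((wperm x ^- m)%g (f a)).
pose h' m := h ((wperm x1 ^- m)%g a).
rewrite (eq_bigr (fun m : 'I_n => (h' m)^-1 * g m * h' m.+1)%g); last first.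
  move=> m _; rewrite base_x1 fxV; congr (_ * h _)%g.
  by rewrite expgS invMg permM.
rewrite telescope_conj /h' /n porbit_expV expg0 invg1 perm1.
by rewrite conjgE mulgA.
Qed.

(** Cycles of [x1] are the cycles of [x] inside the image of [f], and [om] ignores both the starting
    point and the conjugation. Products over separate blocks thereby become products over one common
    set of chosen points. *)
Lemma tilde_fun_emb (om : 'CF(N)) :
  tilde_fun om x1 =
    \prod_(a | is_rep (wperm x) a && (a \in f @: setT)) om (cycprod x a).
Proof.
pose A := [set a | is_rep (wperm x) a && (a \in f @: setT)].
pose F a := f @^-1: porbit (wperm x) a.
have F_f a : F (f a) = porbit (wperm x1) a.
  by apply/setP=> b; rewrite inE (porbit_emb fx) mem_imset.
rewrite /tilde_fun (_ : porbits _ = F @: A); last first.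
  apply/setP=> c; apply/imsetP/imsetP=> [[j _ ->]|[a]].
    have [a aj a_rep] := is_rep_ex (wperm x) (f j).
    have /eqP orb_a : porbit (wperm x) a == porbit (wperm x) (f j).
      by rewrite eq_porbit_mem.
    exists a; last by rewrite -F_f /F orb_a.
    rewrite inE a_rep; move: aj; rewrite (porbit_emb fx) => /imsetP[i _ ->].
    by rewrite imset_f ?inE.
  by rewrite inE => /andP[_ /imsetP[j _ ->]] ->; exists j; rewrite ?F_f.
rewrite big_imset /= => [|a b]; last first.
  rewrite !inE => /andP[a_rep /imsetP[i _ aE]] /andP[b_rep /imsetP[j _ bE]] eq_F.
  apply: (is_rep_inj a_rep b_rep).
  have : j \in F b by rewrite bE F_f porbit_id.
  by rewrite -eq_F inE -bE.
apply: eq_big => [a|a]; rewrite ?inE // => /andP[_ /imsetP[j _ ->]].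
rewrite F_f; case: pickP => [i ij | /(_ j)]; last by rewrite porbit_id.
rewrite cycprod_emb cfunJ ?hN //; apply: cycprod_porbit => //.
by rewrite (porbit_emb fx) imset_f.
Qed.

End TildeEmbedding.

Section WreathOuter.
Variables (gT : finGroupType) (N : {group gT}) (J T : finType) (b : T -> nat).
Variables (om : J -> 'CF(N)) (mu : J -> seq nat).

Definition wr_outer : 'CF(wr_young N b) :=
  \prod_j cfMorph
    ('Res[wr_blk gT b (enum_rank j) @* wr_young N b]
       (tilde (blk b (enum_rank j)) (om j) * infl (blk b (enum_rank j)) N (mu j))).

Lemma wr_outerE x : x \in wr_young N b ->
  wr_outer x =
    \prod_j (tilde_fun (om j) (wr_blk_fun b (enum_rank j) x)
             * chi (blk b (enum_rank j)) (mu j) (perm_blk b (enum_rank j) (wperm x))).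
Proof.
move=> Yx; rewrite prod_cfunE //; apply: eq_bigr => j _.
have sYN : wr_young N b \subset wr_young [set: gT] b.
  apply/subsetP=> y; rewrite in_set => /andP[_ Yy].
  by rewrite in_set Yy andbT inE; apply/forallP=> a; rewrite inE.
have wrN : wr_blk_fun b (enum_rank j) x \in wr (blk b (enum_rank j)) N.
  rewrite inE; apply/forallP=> a; rewrite ffunE.
  by move: Yx; rewrite in_set => /andP[/[!inE]/forallP].
rewrite cfMorphE // cfResE ?mem_morphim ?(subsetP sYN) //.
  by rewrite cfunE /= !cfunE wrN !mulr1n.
apply/subsetP=> _ /morphimP[y Dy Yy ->]; rewrite inE; apply/forallP=> a.
rewrite /= ffunE; move: Yy.
by rewrite in_set => /andP[/[!inE]/forallP].
Qed.

End WreathOuter.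

Section WreathColourings.
Variables (gT : finGroupType) (N : {group gT}) (w : nat) (J : finType).
Variables (om : J -> 'CF(N)) (la : J -> part w).
Hypothesis la_w : (\sum_j psize (la j))%N = w.

Lemma wr_char_colourings (x : wreath gT 'I_w) : x \in wr 'I_w N ->
  wr_char om la x =
    \sum_(c : {ffun 'I_w -> J})
      (\prod_(a | is_rep (wperm x) a) om (c a) (cycprod x a))
      * \prod_j chiX (la j) (wperm x) [set a | c a == j].
Proof.
move=> Nx; pose b := @nat_blocks J (fun j => psize (la j)) w.
have labP (y : {perm 'I_w}) : (y \in young b) = [forall a, lab la_w (y a) == lab la_w a].
  exact: young_lab.
(* The inverse appears because [wperm] reverses products. *)
pose q (y : wreath gT 'I_w) : {ffun 'I_w -> J} := [ffun a => lab la_w (((wperm y)^-1)%g a)].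
apply: (cfInd_fibres (q := q)).
- by apply/subsetP=> y; rewrite in_set => /andP[].
- move=> y z Ny Nz; rewrite in_set groupM ?groupV //= -/b labP.
  apply/eqP/forallP=> [eq_q a|yz].
    have := congr1 (fun c : {ffun 'I_w -> J} => c (wperm z a)) eq_q.
    by rewrite !ffunE permK permM => ->.
  apply/ffunP=> a; have := yz (((wperm z)^-1)%g a); rewrite permM permKV !ffunE.
  by move/eqP.
- move=> y Ny; have Nxy : (x ^ y)%g \in wr 'I_w N by rewrite groupJ.
  have xyE a : wperm y (wperm (x ^ y)%g a) = wperm x (wperm y a).
    by rewrite wpermJ -[a in LHS](permK (wperm y)) permJ permKV.
  have [Ys|nYs] := boolP (wperm (x ^ y)%g \in young b).
    have Yxy : (x ^ y)%g \in wr_young N b by rewrite in_set Nxy.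
    transitivity (wr_outer b om (fun j => pseq (la j)) (x ^ y)%g); first by [].
    rewrite wr_outerE // big_split /=.
    have imE j : [set wperm y (val a) | a in [set: blk b (enum_rank j)]] = [set a | q y a == j].
      apply/setP=> a; rewrite inE ffunE -nat_blocks_eq; apply/imsetP/idP=> [[i _ ->]|ya].
        by rewrite permK; apply: (valP i).
      by exists (exist _ (((wperm y)^-1)%g a) ya); rewrite ?inE ?permKV.
    have f_inj j : injective (fun a : blk b (enum_rank j) => wperm y (val a)).
      by move=> a a' /perm_inj/val_inj.
    have fx j (a : blk b (enum_rank j)) : wperm x (wperm y (val a))
        = wperm y (val (perm_blk b (enum_rank j) (wperm (x ^ y)%g) a)).
      by rewrite perm_blkE // xyE.
    congr (_ * _).
      rewrite (partition_big (q y) xpredT) //=; apply: eq_bigr => j _.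
      rewrite (@tilde_fun_emb gT N _ _ (fun a : blk b (enum_rank j) => wperm y (val a)) _ x
                 (fun a => wbase y (wperm y (val a)))) //.
      + by rewrite imE; apply: eq_big => a; [|case/andP=> _]; rewrite inE // => /eqP->.
      + by move=> a; move: Ny; rewrite inE => /forallP.
      + move=> a; rewrite /= ffunE wbaseJ; congr (_ * wbase y _)%g.
        apply: (@perm_inj _ (wperm x)); rewrite permKV fx.
        by rewrite /= permKV.
    apply: eq_bigr => j _; apply/esym.
    apply: (chiX_emb (f := fun a : blk b (enum_rank j) => wperm y (val a))) => //.
      exact: imE.
    rewrite -(card_lab la_w j) card_sig; apply: eq_card => a.
    by rewrite !inE -nat_blocks_eq.
  rewrite cfun0gen ?genGid; last by rewrite in_set Nxy.
  apply/esym/eqP; apply: contraNT nYs; rewrite mulf_eq0 => /norP[_ /prodf_neq0 nz].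
  rewrite labP; apply/forallP=> a.
  have /chiX_neq0[/perm_stableP/(_ (wperm y a)) + _] := nz (lab la_w a) isT.
  by rewrite !inE !ffunE -xyE !permK eqxx => /eqP <-.
- move=> c; rewrite mulf_eq0 => /norP[_ /prodf_neq0 nz].
  have [|y yc] := @colouring_onto _ _ _ _ la_w c.
    by move=> j; have /chiX_neq0[] := nz j isT.
  exists (Wreath [ffun=> 1%g] y^-1%g).
    by rewrite inE; apply/forallP=> a; rewrite ffunE group1.
  by apply/ffunP=> a; rewrite ffunE /= invgK yc.
Qed.

End WreathColourings.

(** * Induction along the base group of a wreath product *)

Lemma sum_wreath (gT : finGroupType) (T : finType) (N : {group gT}) (b : T -> nat)
    (F : {ffun T -> gT} -> algC) :
  \sum_(y in wr_young N b) F (wbase y) =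
    #|young b|%:R * \sum_(g in ffun_on (mem N)) F g.
Proof.
rewrite (reindex (@unwpair gT T)) /=; last first.
  by exists (@wpair gT T) => y _; [case: y | rewrite wpairK].
rewrite (eq_bigl (fun u => (u.1 \in ffun_on (mem N)) && (u.2 \in young b))); last first.
  move=> [g t]; rewrite in_set /= [_ \in wr _ _]inE; congr (_ && _).
rewrite -(pair_big [in ffun_on (mem N)] [in young b] (fun g _ => F g)) /=.
by rewrite mulr_sumr; apply: eq_bigr => g _; rewrite sumr_const mulr_natl.
Qed.

Lemma card_wr_young (gT : finGroupType) (T : finType) (N : {group gT}) (b : T -> nat) :
  #|wr_young N b|%:R = #|young b|%:R * #|N|%:R ^+ #|T| :> algC.
Proof.
rewrite -sumr_const (sum_wreath N b (fun=> 1)) sumr_const.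
by rewrite card_ffun_on natrX.
Qed.

(** * Summation over the base group *)

Section BaseSum.
Variables (gT : finGroupType) (T : finType) (H G : {group gT}).
Hypothesis sHG : H \subset G.
Variables (x : wreath gT T) (th : T -> 'CF(H)).
Hypothesis Gx : x \in wr T G.
Let s := wperm x.
Implicit Types g : {ffun T -> gT}.

Let conj_base g a := ((g a)^-1 * wbase x a * g ((s^-1)%g a))%g.

(* Keeps g at the chosen point of each cycle and records the base entries of  *)
(* the conjugate of x by g elsewhere; this bijection of G^T turns the sum     *)
(* over g into a sum of products over the points of T, see prod_factor_shift. *)
Let shift g : {ffun T -> gT} :=
  [ffun a => if is_rep s a then g a else conj_base g (s a)].

(** Going backwards along a cycle from its chosen point, each recorded entry determines [g] at the
    next point. *)
Let shift_inj : injective shift.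
Proof.
move=> g1 g2 eq_sh; have shE a : shift g1 a = shift g2 a by rewrite eq_sh.
have repE a : is_rep s a -> g1 a = g2 a.
  by move=> a_rep; have := shE a; rewrite !ffunE a_rep.
apply/ffunP=> c; have [a ac a_rep] := is_rep_ex s c.
have /porbitP[m ->] : c \in porbit s^-1%g a by rewrite porbitV porbit_sym.
elim: m => [|m IHm]; first by rewrite expg0 perm1 repE.
rewrite expgSr permM; set d := ((s^-1 ^+ m)%g a) in IHm *.
have [|nrep] := boolP (is_rep s ((s^-1)%g d)); first exact: repE.
have := shE ((s^-1)%g d); rewrite !ffunE (negPf nrep) /conj_base permKV IHm.
by move/mulgI.
Qed.

Let shift_onto : [set shift g | g in ffun_on (mem G)] = [set g in ffun_on (mem G)].
Proof.
apply/eqP; rewrite eqEcard; apply/andP; split.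
  apply/subsetP=> _ /imsetP[g /ffun_onP Gg ->]; rewrite inE; apply/ffun_onP=> a.
  rewrite ffunE; case: ifP => _; first exact: Gg.
  rewrite /conj_base !groupM ?groupV ?Gg //.
  by move: Gx; rewrite inE => /forallP.
by rewrite card_imset // cardsE.
Qed.

Let factor a u : algC :=
  if is_rep s a then th a (cycprod x a ^ u)%g else (u \in H)%:R.

(** The unchosen points test every base entry except the one at [s a] for each chosen [a]. Since
    [th a] vanishes outside [H], the cycle product at [a] lies in [H], which forces that last entry
    into [H] as well. *)
Lemma prod_factor_shift g :
  \prod_a factor a (shift g a) =
    [forall a, conj_base g a \in H]%:R
      * \prod_(a | is_rep s a) th a (cycprod x a ^ g a)%g.
Proof.
have [/forallP Hg|not] := boolP [forall a, conj_base g a \in H].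
  rewrite mul1r [RHS]big_mkcond; apply: eq_bigr => a _.
  by rewrite /factor ffunE; case: (is_rep s a); rewrite ?Hg.
rewrite mul0r; apply/eqP; apply: contraNT not => /prodf_neq0 nz.
have Hnonrep a : ~~ is_rep s a -> conj_base g (s a) \in H.
  move=> nrep; have := nz a isT; rewrite /factor ffunE (negPf nrep).
  by case: (_ \in H); rewrite ?eqxx.
have Hrep a : is_rep s a -> (cycprod x a ^ g a)%g \in H.
  move=> rep_a; have := nz a isT; rewrite /factor ffunE rep_a.
  by apply: contraR => nH; rewrite cfun0.
apply/forallP=> c; rewrite -[c](permKV s).
have [rep_a|nrep] := boolP (is_rep s ((s^-1)%g c)); last exact: Hnonrep.
set a := (s^-1)%g c in rep_a *.
pose y : wreath gT T := Wreath g 1%g.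
have := Hrep a rep_a.
have -> : (cycprod x a ^ g a)%g = cycprod (x ^ y)%g a by rewrite cycprodJ /= perm1.
rewrite /cycprod; have -> : wperm (x ^ y)%g = s by rewrite wpermJ invg1 conjg1.
have n_gt0 : (0 < #|porbit s a|)%N by rewrite lt0n card_porbit_neq0.
(* The last factor of the cycle product is the untested entry. *)
have lastE : (s ^- #|porbit s a|.-1)%g a = s a.
  apply: (@perm_inj _ s^-1%g).
  by rewrite permK -permM -invMg -expgS prednK // porbit_expV.
have baseE d : wbase (x ^ y)%g d = conj_base g d by rewrite wbaseJ /= perm1.
rewrite -(prednK n_gt0) big_ord_recr /= lastE !baseE groupMl //.
apply: group_prod => m _; rewrite baseE.
have -> : (s ^- m)%g a = s ((s ^- m.+1)%g a) by rewrite expgS invMg permM permKV.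
apply: Hnonrep; set d := (s ^- m.+1)%g a.
have aE : a = (s ^+ m.+1)%g d by rewrite permKV.
have da : d \in porbit s a by rewrite porbit_sym [X in X \in _]aE mem_porbit.
apply/negP=> d_rep; have ad := is_rep_inj rep_a d_rep da.
move/eqP: (esym aE); rewrite -ad -[eqbRHS](perm1 a) -(expg0 s) porbit_expg_eq mod0n.
rewrite modn_small //; have := ltn_ord m; by rewrite -ltnS prednK.
Qed.

(** After reindexing by [shift] the sum factors over the points: a chosen point gives [#|H|] times
    an induced value, any other point gives [#|H|]. *)
Lemma sum_conj_base :
  \sum_(g in ffun_on (mem G))
     [forall a, conj_base g a \in H]%:R
       * \prod_(a | is_rep s a) th a (cycprod x a ^ g a)%g
  = #|H|%:R ^+ #|T| * \prod_(a | is_rep s a) 'Ind[G] (th a) (cycprod x a).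
Proof.
rewrite (eq_bigr _ (fun g _ => esym (prod_factor_shift g))).
transitivity (\sum_(g in ffun_on (mem G)) \prod_a factor a (g a)).
  transitivity (\sum_(g in [set g in ffun_on (mem G)]) \prod_a factor a (g a)).
    rewrite -shift_onto big_imset //= => g1 g2 _ _; exact: shift_inj.
  by apply: eq_bigl => g; rewrite inE.
rewrite -(bigA_distr_big (mem G) factor) [in RHS]big_mkcond /=.
have -> : #|H|%:R ^+ #|T| = \prod_(a : T) #|H|%:R :> algC by rewrite prodr_const.
rewrite -big_split /=; apply: eq_bigr => a _; rewrite /factor.
case: ifP => _; first by rewrite cfIndE // mulrA divff ?mul1r ?neq0CG.
rewrite mulr1 -sumr_const [LHS]big_mkcond [RHS]big_mkcond /=.
apply: eq_bigr => u _; have [Hu|_] := boolP (u \in H); last by rewrite if_same.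
by rewrite (subsetP sHG).
Qed.

End BaseSum.

Section InduceBase.
Variables (gT : finGroupType) (H G : {group gT}) (J : finType).
Hypothesis sHG : H \subset G.

Section Block.
Variables (T : finType) (b : T -> nat) (l : T -> J).
Hypothesis bl : forall a j, (b a == enum_rank j :> nat) = (l a == j).

Lemma wr_outer_rep (N : {group gT}) (om : J -> 'CF(N)) (mu : J -> seq nat) x :
    x \in wr_young N b ->
  wr_outer b om mu x =
    (\prod_(a | is_rep (wperm x) a) om (l a) (cycprod x a))
    * \prod_j chi (blk b (enum_rank j)) (mu j) (perm_blk b (enum_rank j) (wperm x)).
Proof.
move=> Yx; rewrite wr_outerE // big_split /=; congr (_ * _).
have [Nx Yp] : x \in wr T N /\ wperm x \in young b.
  by apply/andP; move: Yx; rewrite in_set.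
rewrite (partition_big l xpredT) //=; apply: eq_bigr => j _.
rewrite (@tilde_fun_emb gT N _ _ (fun a : blk b (enum_rank j) => val a) _ x (fun=> 1%g)) //.
- apply: eq_big => a; last first.
    by case/andP=> _ /imsetP[i _ ->]; have := valP i; rewrite bl => /eqP->.
  congr (_ && _); rewrite -bl; apply/imsetP/idP=> [[i _ ->]|ba]; first exact: (valP i).
  by exists (exist _ a ba).
- exact: val_inj.
- by move=> a; rewrite perm_blkE.
- by move=> a; rewrite /= ffunE invg1 mul1g mulg1.
Qed.

Lemma cfInd_wr_outer (th : J -> 'CF(H)) (mu : J -> seq nat) :
  'Ind[wr_young G b, wr_young H b] (wr_outer b th mu) =
    wr_outer b (fun j => 'Ind[G] (th j)) mu.
Proof.
have sYHG : wr_young H b \subset wr_young G b.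
  apply/subsetP=> y; rewrite in_set => /andP[Hy Yy]; rewrite in_set Yy andbT.
  move: Hy; rewrite !inE => /forallP Hy; apply/forallP=> a.
  exact: (subsetP sHG).
apply/cfun_inP=> x Yx; rewrite cfIndE // (wr_outer_rep _ _ Yx).
have [Gx Yp] : x \in wr T G /\ wperm x \in young b.
  by apply/andP; move: Yx; rewrite in_set.
set C := \prod_j _; pose s := wperm x.
pose F (g : {ffun T -> gT}) := [forall a, ((g a)^-1 * wbase x a * g ((s^-1)%g a))%g \in H]%:R
       * (\prod_(a | is_rep s a) th (l a) (cycprod x a ^ g a)%g) * C.
rewrite (eq_bigr (fun y => F (wbase y))) => [|y Gy]; last first.
  (* The permutation part of [y] lies in [wr_young H b], so only its base part affects the
     summand. *)
  pose y0 : wreath gT T := Wreath (wbase y) 1%g.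
  pose y1 : wreath gT T := Wreath [ffun=> 1%g] (wperm y).
  have Yy1 : y1 \in wr_young H b.
    move: Gy; rewrite in_set => /andP[_ Yy]; rewrite in_set Yy andbT inE.
    by apply/forallP=> a; rewrite ffunE group1.
  have -> : y = (y0 * y1)%g.
    case: y @y0 @y1 {Gy Yy1} => g t /=; congr Wreath; last by rewrite /= mulg1.
    by apply/ffunP=> a; rewrite !ffunE mulg1.
  rewrite conjgM cfunJ //; have -> : wbase (y0 * y1)%g = wbase y0.
    by apply/ffunP=> a; rewrite wbaseM ffunE mulg1.
  have px : wperm (x ^ y0)%g = s by rewrite wpermJ invg1 conjg1.
  have bx a : wbase (x ^ y0)%g a = ((wbase y0 a)^-1 * wbase x a * wbase y0 ((s^-1)%g a))%g.
    by rewrite wbaseJ /= perm1.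
  rewrite /F; under eq_forallb => a do rewrite -bx.
  have [/forallP Hx|not] := boolP [forall a, wbase (x ^ y0)%g a \in H]; last first.
    by rewrite !mul0r cfun0 // in_set negb_and inE not.
  have Yxy : (x ^ y0)%g \in wr_young H b.
    rewrite in_set px Yp andbT inE; exact/forallP.
  rewrite wr_outer_rep // px mul1r; congr (_ * _); apply: eq_bigr => a _.
  by rewrite cycprodJ /= perm1.
rewrite (sum_wreath G b F) /F -mulr_suml sum_conj_base // card_wr_young.
by rewrite -(mulrA _ _ C) [X in _ * X]mulrA mulKf // mulf_neq0 ?expf_neq0 ?neq0CG.
Qed.

End Block.

(** Transitivity of induction: the Young-type subgroup over [H] reaches the wreath product over [G]
    either through the wreath product over [H] or through the Young-type subgroup over [G]. *)
Lemma cfInd_wr_char w (th : J -> 'CF(H)) (la : J -> part w) :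
    (\sum_j psize (la j))%N = w ->
  'Ind[wr 'I_w G, wr 'I_w H] (wr_char th la) = wr_char (fun j => 'Ind[G] (th j)) la.
Proof.
move=> la_w; pose b := @nat_blocks J (fun j => psize (la j)) w.
have sub (N : {group gT}) : wr_young N b \subset wr 'I_w N.
  by apply/subsetP=> y; rewrite in_set => /andP[].
have sYHG : wr_young H b \subset wr_young G b.
  apply/subsetP=> y; rewrite in_set => /andP[Hy Yy]; rewrite in_set Yy andbT.
  move: Hy; rewrite !inE => /forallP Hy; apply/forallP=> a.
  exact: (subsetP sHG).
have swHG : wr 'I_w H \subset wr 'I_w G.
  apply/subsetP=> y; rewrite !inE => /forallP Hy; apply/forallP=> a.
  exact: (subsetP sHG).
transitivity ('Ind[wr 'I_w G] ('Ind[wr_young G b] (wr_outer b th (fun j => pseq (la j))))).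
  exact: etrans (cfIndInd _ swHG (sub H)) (esym (cfIndInd _ (sub G) sYHG)).
by rewrite (cfInd_wr_outer (l := lab la_w)) // => a j; rewrite nat_blocks_eq.
Qed.

End InduceBase.

(** * Splitting off the part labelled by r *)

Lemma big_Iset (R : Type) (idx : R) (op : Monoid.com_law idx) p (r : 'I_p) (F : 'I_p -> R) :
  \big[op/idx]_k F k = op (F r) (\big[op/idx]_(i : Iset r) F (val i)).
Proof.
rewrite (bigD1 r) //=; congr (op _ _).
rewrite (reindex_omap (val : Iset r -> 'I_p) insub) /=; last first.
  by move=> k kr; rewrite insubT.
by apply: eq_bigl => i; rewrite valK eqxx andbT; apply: (valP i).
Qed.

Section RepSum.
Variables (T : finType) (s : {perm T}).

Definition crep (a : T) := odflt a [pick i in porbit s a].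

Lemma crep_porbit a : crep a \in porbit s a.
Proof. by rewrite /crep; case: pickP => //= _; rewrite porbit_id. Qed.

Lemma is_repE a : is_rep s a = (crep a == a).
Proof.
rewrite /is_rep /crep; case: pickP => [b _|/(_ a)]; last by rewrite porbit_id.
by [].
Qed.

Lemma crep_eq a b : b \in porbit s a -> crep b = crep a.
Proof.
rewrite -eq_porbit_mem => /eqP ba; rewrite /crep ba.
by case: pickP => // /(_ a); rewrite porbit_id.
Qed.

Lemma perm_stable_porbit (B : {set T}) a b :
  perm_stable s B -> b \in porbit s a -> (b \in B) = (a \in B).
Proof.
move=> /perm_stableP sB /porbitP[n ->]; elim: n => [|n IHn]; first by rewrite perm1.
by rewrite expgSr permM sB.
Qed.

(** Stable sets are unions of cycles, so they correspond to sets of chosen points, over which the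
    product distributes. *)
Lemma prod_rep_add (F R : T -> algC) :
  \prod_(a | is_rep s a) (F a + R a) =
  \sum_(B : {set T} | perm_stable s B)
    \prod_(a | is_rep s a) (if a \in B then R a else F a).
Proof.
(* At unchosen points the factor is written [1 + 0], so only subsets containing all of them
   survive. *)
pose F' a := if is_rep s a then F a else 0; pose R' a := if is_rep s a then R a else 1.
transitivity (\prod_a (R' a + F' a)).
  rewrite big_mkcond; apply: eq_bigr => a _; rewrite /F' /R'.
  by case: ifP; rewrite ?addr0 // addrC.
rewrite bigA_distr (bigID (fun D : {set T} => [forall a, ~~ is_rep s a ==> (a \in D)])) /=.
rewrite [X in _ + X]big1 ?addr0 => [|D]; last first.
  rewrite negb_forall => /existsP[a]; rewrite negb_imply => /andP[nrep aD].
  by apply/eqP/prodf_eq0; exists a; rewrite // (negPf aD) /F' (negPf nrep).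
pose h (B : {set T}) := [set a | is_rep s a ==> (a \in B)].
pose h' (D : {set T}) := [set a | crep a \in D].
rewrite (reindex_onto h h') /=; last first.
  move=> D /forallP nrepD; apply/setP=> a; rewrite !inE.
  have := nrepD a; rewrite is_repE; case: eqP => [-> //|_] /=; exact: esym.
have rep_crep a : is_rep s (crep a).
  by rewrite is_repE (crep_eq (crep_porbit a)).
apply: eq_big => [B|B _]; last first.
  rewrite [RHS]big_mkcond; apply: eq_bigr => a _; rewrite /F' /R' inE.
  by case: (is_rep s a).
rewrite (_ : [forall a, _]) ?andTb; last first.
  by apply/forallP=> a; rewrite inE; case: (is_rep s a).
apply/eqP/idP=> [hB|sB].
  apply/perm_stableP=> a; rewrite -hB !inE (@crep_eq a (s a)) //.
  by have := mem_porbit s 1 a; rewrite expg1.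
apply/setP=> a; rewrite !inE rep_crep /=.
exact: perm_stable_porbit (crep_porbit a).
Qed.

End RepSum.

Section Split.
Variables (p : nat) (r : 'I_p) (i0 : Iset r) (gT : finGroupType) (G : {group gT}).
Variables (psi : 'I_p -> 'CF(G)) (w : nat) (al : {ffun Iset r -> part w}).
Hypothesis al_w : msize al = w.

(** Absorbing the size condition makes the sums run over all families, so that they can be exchanged
    with products. *)
Let LRc (la be ga : part w) : algC :=
  if (psize be + psize ga == psize la)%N then LR2 la be ga else 0.

Let kcoefE (ga : {ffun 'I_p -> part w}) :
  kcoef al ga = \sum_(be : {ffun Iset r -> part w})
     (\prod_i LRc (al i) (be i) (ga (val i))) * LRfam (ga r) be.
Proof.
rewrite /kcoef big_mkcond; apply: eq_bigr => be _.
case: ifP => [/forallP sz | /negbT].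
  by congr (_ * _); apply: eq_bigr => i _; rewrite /LRc sz.
rewrite negb_forall => /existsP[i nsz].
by rewrite (bigD1 i) //= /LRc (negPf nsz) !mul0r.
Qed.

Let merge (u : {ffun Iset r -> part w} * part w) : {ffun 'I_p -> part w} :=
  [ffun k => if insub k is Some i then u.1 i else u.2].

Let merge_r u : merge u r = u.2.
Proof. by rewrite ffunE insubF // eqxx. Qed.

Let merge_val u i : merge u (val i) = u.1 i.
Proof. by rewrite ffunE valK. Qed.

Let merge_bij : bijective merge.
Proof.
exists (fun ga : {ffun 'I_p -> part w} => ([ffun i : Iset r => ga (val i)], ga r)) => [u|ga].
  rewrite merge_r [RHS]surjective_pairing; congr (_, _).
  by apply/ffunP=> i; rewrite ffunE merge_val.
apply/ffunP=> k; have [->|kr] := eqVneq k r; first by rewrite merge_r.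
by rewrite -[k]/(val (exist _ k kr : Iset r)) merge_val ffunE.
Qed.

Let col (c : {ffun 'I_w -> Iset r}) i := [set a | c a == i].

Lemma wr_char_addr :
  wr_char (fun i : Iset r => psi (val i) + psi r) al
    = \sum_(ga : {ffun 'I_p -> part w} | msize ga == w) kcoef al ga *: wr_char psi ga.
Proof.
apply/cfun_inP=> x Gx; set s := wperm x; pose cyc := cycprod x.
rewrite wr_char_colourings // sum_cfunE.
pose W (be ga : {ffun Iset r -> part w}) (c : {ffun 'I_w -> Iset r}) (B : {set 'I_w}) :=
  (\prod_(a | is_rep s a) (if a \in B then psi r (cyc a) else psi (val (c a)) (cyc a)))
  * (\prod_i chiX (be i) s (col c i :&: B) * \prod_i chiX (ga i) s (col c i :\: B)).
transitivity (\sum_(be : {ffun Iset r -> part w}) \sum_(ga : {ffun Iset r -> part w})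
    (\prod_i LRc (al i) (be i) (ga i)) *
    \sum_(c : {ffun 'I_w -> Iset r}) \sum_(B : {set 'I_w}) W be ga c B).
  under [RHS]eq_bigr => be _.
    under eq_bigr => ga _ do rewrite mulr_sumr.
    rewrite exchange_big /=; over.
  rewrite exchange_big /=; apply: eq_bigr => c _.
  under [RHS]eq_bigr => be _.
    under eq_bigr => ga _ do rewrite mulr_sumr.
    rewrite exchange_big /=; over.
  rewrite exchange_big /=.
  rewrite (eq_bigr (fun a => psi (val (c a)) (cyc a) + psi r (cyc a))); last first.
    by move=> a _; rewrite cfunE.
  rewrite prod_rep_add mulr_suml [RHS](bigID (fun B => perm_stable s B)) /=.
  rewrite [X in _ + X]big1 ?addr0 => [|B nsB]; last first.
    rewrite big1 // => be _; rewrite big1 // => ga _; apply/eqP.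
    apply: contraNT nsB; rewrite /W !mulf_eq0 !negb_or.
    case/and4P=> _ _ /prodf_neq0 nz _; apply: (@perm_stable_cover _ _ s c) => i.
    by rewrite setIC; have /chiX_neq0[] := nz i isT.
  apply: eq_bigr => B sB.
  under [RHS]eq_bigr => be _.
    under eq_bigr => ga _ do rewrite mulrCA -!big_split /=.
    rewrite -mulr_sumr
      -(bigA_distr_bigA (fun i ga => LRc (al i) (be i) ga *
          (chiX (be i) s (col c i :&: B) * chiX ga s (col c i :\: B)))).
    over.
  rewrite -mulr_sumr -(bigA_distr_bigA (fun i be => \sum_ga LRc (al i) be ga *
          (chiX be s (col c i :&: B) * chiX ga s (col c i :\: B)))).
  congr (_ * _); apply: eq_bigr => i _; rewrite (chiX_LR2 _ _ sB).
  apply: eq_bigr => be _; rewrite big_mkcond; apply: eq_bigr => ga _.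
  by rewrite /LRc; case: ifP; rewrite ?mul0r.
rewrite (reindex merge) /=; last exact: onW_bij merge_bij.
rewrite -(pair_big_dep xpredT (fun ga gr => msize (merge (ga, gr)) == w)
  (fun ga gr => (kcoef al (merge (ga, gr)) *: wr_char psi (merge (ga, gr))) x)) /=.
rewrite exchange_big /=; apply: eq_bigr => ga _.
under [RHS]eq_bigr => gr _ do rewrite cfunE kcoefE mulr_suml.
rewrite exchange_big /=; apply: eq_bigr => be _.
have [LR0|/prodf_neq0 LRnz] := eqVneq (\prod_i LRc (al i) (be i) (ga i)) 0.
  rewrite LR0 mul0r big1 // => gr _.
  under [X in X * _ * _]eq_bigr => i _ do rewrite merge_val /=.
  by rewrite LR0 !mul0r.
have sz i : (psize (be i) + psize (ga i))%N = psize (al i).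
  by have := LRnz i isT; rewrite /LRc; case: ifP => [/eqP //|_]; rewrite eqxx.
have sz_sum : (\sum_i psize (be i) + \sum_i psize (ga i))%N = w.
  by rewrite -big_split -[RHS]al_w; apply: eq_bigr => i _; exact: sz.
(* Since the sizes of [be] and [ga] add up to those of [al], total size [w] fixes the size of the
   component at [r]. *)
rewrite (eq_bigl (fun gr : part w => psize gr == (\sum_i psize (be i))%N)); last first.
  move=> gr; rewrite /msize (big_Iset _ r) merge_r /=.
  under eq_bigr => i _ do rewrite merge_val /=.
  by rewrite -[X in _ == X]sz_sum eqn_add2r.
transitivity (\sum_(f : {ffun 'I_w -> 'I_p}) \prod_i LRc (al i) (be i) (ga i) *
  ((\prod_(a | is_rep s a) psi (f a) (cyc a)) * \prod_i chiX (ga i) s [set a | f a == val i] *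
  \sum_(gr : part w | psize gr == (\sum_i psize (be i))%N)
     LRfam gr be * chiX gr s [set a | f a == r])); last first.
  rewrite [RHS](eq_bigr (fun gr => \sum_(f : {ffun 'I_w -> 'I_p})
     \prod_i LRc (al i) (be i) (ga i) * ((\prod_(a | is_rep s a) psi (f a) (cyc a))
      * \prod_i chiX (ga i) s [set a | f a == val i] *
      (LRfam gr be * chiX gr s [set a | f a == r])))) => [|gr /eqP gr_sz]; last first.
    under [X in X * _ * _]eq_bigr => i _ do rewrite merge_val /=.
    rewrite merge_r /= wr_char_colourings //; last first.
      rewrite (big_Iset _ r) merge_r /=.
      under eq_bigr => i _ do rewrite merge_val /=.
      by rewrite gr_sz.
    rewrite -mulrA !mulr_sumr; apply: eq_bigr => f _.
    rewrite (big_Iset _ r) merge_r /=.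
    rewrite -/s [X in _ * (_ * (_ * (_ * X))) = _](eq_bigr
      (fun i : Iset r => chiX (ga i) s [set a | f a == val i])); last first.
      by move=> i _; congr (chiX _ _ _); apply: merge_val.
    by rewrite /cyc; ring.
  rewrite exchange_big /=; apply: eq_bigr => f _.
  by rewrite -mulr_sumr -mulr_sumr.
rewrite -mulr_sumr; congr (_ * _).
(* Off the colour [r] this is [f] itself; the default [i0] is taken only where [f a = r], where
   [compat] imposes nothing. *)
pose c0 (f : {ffun 'I_w -> 'I_p}) a : Iset r := odflt i0 (insub (f a)).
pose compat (c : {ffun 'I_w -> Iset r}) (f : {ffun 'I_w -> 'I_p}) :=
  [forall a, (a \notin [set a | f a == r]) ==> (c a == c0 f a)].
have le_be : (\sum_i psize (be i) <= w)%N by rewrite -[leqRHS]sz_sum leq_addr.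
under [RHS]eq_bigr => f _.
  rewrite (sum_LRfam s [set a | f a == r] (c0 f) le_be) mulr_sumr.
  over.
rewrite [RHS](exchange_big_dep xpredT) //=; apply: eq_bigr => c _.
(* For fixed [c], the compatible [f] correspond to the sets [B] on which [f] takes the colour
   [r]. *)
pose f_of (B : {set 'I_w}) : {ffun 'I_w -> 'I_p} := [ffun a => if a \in B then r else val (c a)].
have f_of_r B : [set a | f_of B a == r] = B.
  apply/setP=> a; rewrite inE ffunE; case: ifP; rewrite ?eqxx // => _.
  exact/negbTE/(valP (c a)).
rewrite [RHS](reindex_onto f_of (fun f => [set a | f a == r])) /=; last first.
  move=> f /forallP c_f; apply/ffunP=> a; rewrite ffunE inE.
  have := c_f a; rewrite inE; case: eqP => [-> //|/eqP far] /= /eqP ->.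
  by rewrite /c0 insubT.
apply: eq_big => [B|B _].
  rewrite f_of_r eqxx andbT; apply/esym/forall_inP=> a.
  by rewrite /c0 ffunE => /negPf->; rewrite valK.
rewrite /W f_of_r -mulrA; congr (_ * _).
  by apply: eq_bigr => a _; rewrite ffunE; case: ifP.
rewrite mulrC; congr (_ * _); apply: eq_bigr => i _; congr (chiX _ _ _).
  apply/setP=> a; rewrite !inE ffunE; case: ifP => _ /=; last by rewrite val_eqE.
  by apply/esym/negbTE; rewrite eq_sym (valP i).
by rewrite setIC.
Qed.

End Split.

(** * The affine group of the line *)

Section Affine.
Variables (gT : finGroupType) (G P H : {group gT}) (defG : P ><| H = G).
Hypotheses (P_gt2 : (2 < #|P|)%N) (abH : abelian H) (cardH : #|H| = #|P|.-1).
Variable k0 : Iirr G.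
Hypothesis k0_deg : 'chi_k0 1%g = (#|P|.-1)%:R.

Let chiH1 (j : Iirr H) : 'chi_j 1%g = 1.
Proof. exact/lin_char1/char_abelianP. Qed.

Let cardG : #|G| = (#|P| * #|P|.-1)%N.
Proof. by rewrite -(sdprod_card defG) cardH. Qed.

Let sd_notin : k0 \notin [set sdprod_Iirr defG j | j in setT].
Proof.
apply/imsetP=> -[j _ k0E]; move: k0_deg.
rewrite k0E sdprod_IirrE cfSdprod1 chiH1 => /eqP; rewrite eq_sym pnatr_eq1.
by case: #|P| P_gt2 => [|[|[]]].
Qed.

(* The squares of the degrees of the inflated characters and of chi_k0        *)
(* already add up to #|P|.-1 + #|P|.-1 ^ 2 = #|G|.                            *)
Lemma affine_irr : [set: Iirr G] = k0 |: [set sdprod_Iirr defG j | j in setT].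
Proof.
set D := _ |: _; apply/eqP; rewrite eq_sym eqEsubset subsetT; apply/subsetP=> k _.
have /eqP := irr_sum_square G; rewrite (bigID (mem D)) /=.
rewrite (_ : \sum_(i in D) _ = #|G|%:R); last first.
  rewrite big_setU1 //= big_imset => [|i j _ _]; last exact: sdprod_Iirr_inj.
  rewrite (eq_bigr (fun=> 1)) => [|j _]; last first.
    by rewrite sdprod_IirrE cfSdprod1 chiH1 expr1n.
  rewrite sumr_const cardsT card_Iirr_abelian // cardH k0_deg cardG.
  rewrite -natrX -natrD; congr (_%:R).
  by case: #|P| P_gt2 => // m _ /=; rewrite mulSn expnS expn1 addnC.
rewrite -subr_eq0 addrAC subrr add0r psumr_eq0 => [/allP /(_ k)|i _]; last first.
  by rewrite exprn_ge0 // ltW // irr1_gt0.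
by rewrite mem_index_enum expf_eq0 /= (negPf (irr1_neq0 k)) implybF negbK => /(_ isT).
Qed.

(** By Frobenius reciprocity the inflation of ['chi_j] is the only inflated constituent, with
    multiplicity one. Comparing degrees, [#|P| = 1 + m * #|P|.-1], hence [m = 1]. *)
Lemma affine_Ind_irr j :
  'Ind[G] 'chi[H]_j = 'chi_(sdprod_Iirr defG j) + 'chi_k0.
Proof.
have [_ /mulG_sub[_ sHG] _ _] := sdprodP defG.
pose m := '['Ind[G] 'chi_j, 'chi_k0].
have IndE : 'Ind[G] 'chi_j = 'chi_(sdprod_Iirr defG j) + m *: 'chi_k0.
  rewrite {1}['Ind _]cfun_sum_cfdot (eq_bigl (mem [set: Iirr G])); last first.
    by move=> k; rewrite /= inE.
  rewrite affine_irr big_setU1 //= addrC big_imset /= => [|i i' _ _]; last exact: sdprod_Iirr_inj.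
  congr (_ + _); rewrite (bigD1 j) ?inE //= big1 ?addr0 => [|i /andP[_ neq]].
    by rewrite -cfdot_Res_r sdprod_IirrE cfSdprodK cfnorm_irr scale1r.
  by rewrite -cfdot_Res_r sdprod_IirrE cfSdprodK cfdot_irr eq_sym (negPf neq) scale0r.
rewrite IndE; have := congr1 (fun phi : 'CF(G) => phi 1%g) IndE.
rewrite cfInd1 // !cfunE k0_deg sdprod_IirrE cfSdprod1 chiH1 mulr1.
rewrite -divgS // cardG cardH mulnK; last by case: #|P| P_gt2 => [|[]].
case: #|P| P_gt2 => [//|q] /= q_gt1; rewrite -natr1 addrC => /addrI.
rewrite -{1}[q%:R]mul1r => /mulIf <-; first by rewrite scale1r.
by rewrite pnatr_eq0 -lt0n ltnW.
Qed.

End Affine.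

Unset Implicit Arguments.

Theorem theorem5p1
  (p : nat) (p_prime : prime p) (p_odd : odd p)
  (* the index r, label (p + 1) / 2 *)
  (r : 'I_p) (def_r : r.+1 = (p.+1)./2 :> nat)
  (* G = Z_p : Z_(p - 1) with faithful action, and its complement H *)
  (gT : finGroupType) (G P H : {group gT}) (defG : P ><| H = G)
  (cardP : #|P| = p) (cycH : cyclic H) (cardH : #|H| = p.-1)
  (faithH : 'C_H(P) = 1%g)
  (* the labelling of Irr(H), with theta_1 = 1_H *)
  (theta : Iset r -> Iirr H) (theta_bij : bijective theta)
  (theta1 : forall i : Iset r, val i = 0%N :> nat -> 'chi_(theta i) = 1)
  (* the characters psi_i = theta_i o varpi of G, and psi_r of degree p - 1 *)
  (psi : 'I_p -> 'CF(G))
  (psi_infl : forall i : Iset r, psi (val i) = cfSdprod defG 'chi_(theta i))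
  (psi_r_irr : psi r \in irr G) (psi_r_deg : psi r 1%g = (p.-1)%:R)
  (w : nat) (w_gt0 : (0 < w)%N)
  (al : {ffun Iset r -> part w}) (al_w : msize al = w) :
  'Ind[wr 'I_w G, wr 'I_w H] (wr_char (fun i => 'chi_(theta i)) al)
    = \sum_(ga : {ffun 'I_p -> part w} | msize ga == w)
        kcoef al ga *: wr_char psi ga
  /\ (forall ga : {ffun 'I_p -> part w}, msize ga = w ->
        ~ (forall i : Iset r, (psize (ga (val i)) <= psize (al i))%N) ->
        kcoef al ga = 0).
Proof.
have p_gt2 : (2 < p)%N by apply: odd_prime_gt2.
split; last first.
  move=> ga _ not_le; rewrite /kcoef big1 // => be /forallP sz.
  by case: not_le => i; rewrite -(eqP (sz i)) leq_addl.
have [_ /mulG_sub[_ sHG] _ _] := sdprodP defG.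
have [theta' _ thetaK] := theta_bij.
(* The label of the trivial character serves as the element of [I] required for default colours. *)
rewrite cfInd_wr_char // -(wr_char_addr (theta' 0)) //.
have [k0 psi_r] := irrP psi_r_irr.
have eq_om : (fun i => 'Ind[G] 'chi_(theta i)) =1 (fun i : Iset r => psi (val i) + psi r).
  move=> i; rewrite psi_r psi_infl -sdprod_IirrE; apply: affine_Ind_irr => //.
  - by rewrite cardP.
  - exact: cyclic_abelian.
  - by rewrite cardP.
  - by rewrite -psi_r cardP.
rewrite /wr_char; congr ('Ind _); apply: eq_bigr => i _.
by rewrite eq_om.
Qed.
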